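(* Let $\Delta$ be a simplicial complex on vertex set $[n]=\{1,\dots,n\}$, and let $W_i(\Delta)$ denote its Koszul modules over $S=\Bbbk[x_1,\dots,x_n]$. For any $i\ge 1$ and any square-free multi-index $\mathbf{b}\in\mathbb{N}^n$, there is a natural isomorphism of $\Bbbk$-vector spaces $$[W_i(\Delta)]_{\mathbf{b}}\;\cong\;\bigl[\operatorname{Tor}^S_{|\mathbf{b}|-i}(\Bbbk,\Bbbk[\Delta])\bigr]_{\mathbf{b}}^{\vee},$$ where $\Bbbk[\Delta]$ is the polynomial Stanley--Reisner ring of $\Delta$.
   Context: $\Bbbk$ is a field of characteristic $0$ and $S=\Bbbk[x_1,\dots,x_n]$ with the $\mathbb{N}^n$-grading $\deg x_i=\mathbf{e}_i$ (the $i$-th standard basis vector). A simplicial complex $\Delta$ on vertex set $[n]$ is a collection of subsets (faces) of $[n]$ closed under taking subsets and containing $\emptyset$ and all singletons $\{i\}$. The polynomial Stanley--Reisner ring is $\Bbbk[\Delta]=S/I_\Delta$, where $I_\Delta$ is the ideal generated by the monomials $x_{i_1}\cdots x_{i_s}$ over all $\{i_1<\dots<i_s\}\notin\Delta$. Koszul modules: let $V$ be a $\Bbbk$-vector space with basis $v_1,\dots,v_n$, $\deg v_i=\mathbf{e}_i$, and let $\mathbf{K}_\bullet=\bigwedge^\bullet V\otimes_\Bbbk S$ be the Koszul complex of $x_1,\dots,x_n$, with differential $\partial(v_{j_1}\wedge\cdots\wedge v_{j_i})=\sum_{k}(-1)^{k-1}x_{j_k}\,v_{j_1}\wedge\cdots\widehat{v_{j_k}}\cdots\wedge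 v_{j_i}$. Let $\mathbf{K}^\Delta_\bullet\subseteq\mathbf{K}_\bullet$ be the subcomplex whose $i$-th term is the free $S$-module generated by those $v_{j_1}\wedge\cdots\wedge v_{j_i}$ with $\{j_1,\dots,j_i\}\in\Delta$. Then $W_i(\Delta):=H_i(\mathbf{K}^\Delta_\bullet)$, an $\mathbb{N}^n$-graded $S$-module. A multi-index $\mathbf{b}\in\mathbb{N}^n$ is square-free if all its entries are $0$ or $1$; $|\mathbf{b}|$ is the sum of its entries; $[M]_{\mathbf{b}}$ is the component of multidegree $\mathbf{b}$; $^\vee$ is the $\Bbbk$-dual. $\operatorname{Tor}^S(\Bbbk,\Bbbk[\Delta])$ carries its natural $\mathbb{N}^n$-grading and is zero in negative homological degree. *)

(* Defs.v *)
From HB Require Import structures.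
From mathcomp Require Import all_boot all_order all_algebra.
From mathcomp Require Import ring_quotient generic_quotient.
From mathcomp Require Import mpoly.
From mathcomp Require Import boolp.
From mathcomp Require Import zify ring.

Set Implicit Arguments.
Unset Strict Implicit.
Unset Printing Implicit Defensive.
Set Warnings "-redundant-canonical-projection,-projection-no-head-constant".

Import GRing.Theory.
Local Open Scope ring_scope.
Local Open Scope quotient_scope.

Section Submodules.
Variables (R : nzRingType) (M : lmodType R).

Record submodule := Submodule {
  submod_pred :> {pred M};
  submod_closedP : submod_closed submod_pred }.

HB.instance Definition _ (N : submodule) :=
  GRing.isSubmodClosed.Build R M (submod_pred N) (submod_closedP N).

Record submod_of (N : submodule) :=
  SubmodOf { submod_val : M; submod_valP : submod_val \in submod_pred N }.

HB.instance Definition _ N := [isSub for @submod_val N].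
HB.instance Definition _ N := [Choice of submod_of N by <:].
HB.instance Definition _ N :=
  [SubChoice_isSubLmodule of submod_of N by <:].

Definition quot_of (N : submodule) := Quotient.quot (submod_pred N).

HB.instance Definition _ N := ZmodQuotient.on (quot_of N).

Variable N : submodule.
Local Notation Q := (quot_of N).

Lemma quot_eqP (x y : M) : (\pi_Q x = \pi_Q y) <-> (x - y \in submod_pred N).
Proof.
by rewrite Quotient.idealrBE; split => [/eqP|/eqP].
Qed.

Definition quot_scale (a : R) (x : Q) : Q := \pi_Q (a *: repr x).

Lemma pi_scale a (x : M) : quot_scale a (\pi_Q x) = \pi_Q (a *: x).
Proof.
rewrite /quot_scale; apply/quot_eqP; rewrite -scalerBr rpredZ //.
by apply/quot_eqP; rewrite reprK.
Qed.

Lemma quot_ind (P : Q -> Prop) : (forall x, P (\pi_Q x)) -> forall x, P x.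
Proof. by move=> h x; rewrite -[x]reprK. Qed.

Lemma quot_scaleA a b v : quot_scale a (quot_scale b v) = quot_scale (a * b) v.
Proof. by elim/quot_ind: v => v; rewrite !pi_scale scalerA. Qed.
Lemma quot_scale1 : left_id 1 quot_scale.
Proof. by elim/quot_ind => v; rewrite !pi_scale scale1r. Qed.
Lemma quot_scaleDr : right_distributive quot_scale +%R.
Proof.
move=> a; elim/quot_ind => u; elim/quot_ind => v.
by rewrite !pi_scale -!raddfD /= pi_scale scalerDr raddfD.
Qed.
Lemma quot_scaleDl v : {morph quot_scale^~ v : a b / a + b}.
Proof.
by elim/quot_ind: v => v a b /=; rewrite !pi_scale -!raddfD scalerDl.
Qed.

HB.instance Definition _ := GRing.Zmodule_isLmodule.Build R Q
  quot_scaleA quot_scale1 quot_scaleDr quot_scaleDl.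

Lemma pi_linear : scalable (\pi_Q : M -> Q).
Proof. by move=> a x; rewrite -pi_scale. Qed.
HB.instance Definition _ := GRing.isScalable.Build R M Q *:%R \pi_Q pi_linear.

End Submodules.

Section Dual.
Variables (k : fieldType) (V : lmodType k).

Definition dual := {linear V -> k^o}.
HB.instance Definition _ := gen_eqMixin dual.
HB.instance Definition _ := gen_choiceMixin dual.

Implicit Types f g h : dual.

Lemma dual_ext f g : (forall x, f x = g x) -> f = g.
Proof.
move: f g => [f [[fa] [fs]]] [g [[ga] [gs]]] /= /funext e.
by subst g; rewrite (Prop_irrelevance fa ga) (Prop_irrelevance fs gs).
Qed.

Definition dual_zero : dual := \0.
Definition dual_add f g : dual := f \+ g.
Definition dual_scale a f : dual := a \*: f.

Fact dual_addA : associative dual_add.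
Proof. by move=> f g h; apply: dual_ext => x /=; rewrite addrA. Qed.
Fact dual_addC : commutative dual_add.
Proof. by move=> f g; apply: dual_ext => x /=; rewrite addrC. Qed.
Fact dual_add0 : left_id dual_zero dual_add.
Proof. by move=> f; apply: dual_ext => x /=; rewrite add0r. Qed.
Fact dual_addN : left_inverse dual_zero (dual_scale (-1)) dual_add.
Proof.
by move=> f; apply: dual_ext => x /=; rewrite scaleN1r addNr.
Qed.
HB.instance Definition _ :=
  GRing.isZmodule.Build dual dual_addA dual_addC dual_add0 dual_addN.

Fact dual_scaleA a b f : dual_scale a (dual_scale b f) = dual_scale (a * b) f.
Proof. by apply: dual_ext => x /=; rewrite scalerA. Qed.
Fact dual_scale1 : left_id 1 dual_scale.
Proof. by move=> f; apply: dual_ext => x /=; rewrite scale1r. Qed.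
Fact dual_scaleDr : right_distributive dual_scale +%R.
Proof. by move=> a f g; apply: dual_ext => x /=; rewrite scalerDr. Qed.
Fact dual_scaleDl f : {morph dual_scale^~ f : a b / a + b}.
Proof. by move=> a b; apply: dual_ext => x /=; rewrite scalerDl. Qed.
HB.instance Definition _ := GRing.Zmodule_isLmodule.Build k dual
  dual_scaleA dual_scale1 dual_scaleDr dual_scaleDl.

End Dual.


Section GradedModules.
Variables (k : fieldType) (n : nat).
Local Notation S := {mpoly k[n]}.

(* An N^n-graded S-module.  The decomposition M = \bigoplus_b M_b is recorded
   by the projections [gproj b] onto the homogeneous components M_b; [gprojM]
   says both that these are k-linear (m = 0) and that X^m M_b is contained in
   M_(b + m). *)
Record gradedModule := GradedModule {
  gcar :> lmodType S;
  gproj : 'X_{1..n} -> gcar -> gcar;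
  gprojB : forall b, zmod_morphism (gproj b);
  gprojK : forall b c x,
    gproj b (gproj c x) = if b == c then gproj c x else 0;
  gproj_sum : forall x, exists s : seq 'X_{1..n},
    uniq s /\ x = \sum_(b <- s) gproj b x;
  gprojM : forall (a : k) m b x,
    gproj b ((a *: 'X_[m] : S) *: x) =
      if (m <= b)%MM then (a *: 'X_[m] : S) *: gproj (b - m)%MM x else 0 }.

HB.instance Definition _ (M : gradedModule) b :=
  GRing.isZmodMorphism.Build M M (gproj b) (gprojB b).

Lemma gprojZ (M : gradedModule) (a : k) b (x : M) :
  gproj b (a%:MP *: x) = a%:MP *: gproj b x.
Proof.
have e : a%:MP = a *: 'X_[0] :> S by rewrite mpolyX0 -mul_mpolyC mulr1.
rewrite e gprojM subm0; case: ifP => // /mnm_lepP [] i.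
by rewrite mnmE.
Qed.

Definition homogeneous (M : gradedModule) b : {pred M} :=
  fun x => gproj b x == x.
Arguments homogeneous : clear implicits.

(* [M]_b, as a k-vector space *)
Record component (M : gradedModule) (b : 'X_{1..n}) :=
  Component { cval : M; cvalP : cval \in homogeneous M b }.

Section Component.
Variables (M : gradedModule) (b : 'X_{1..n}).

HB.instance Definition _ := [isSub for @cval M b].
HB.instance Definition _ := [Choice of component M b by <:].

Fact homogeneous_zmod_closed : zmod_closed (homogeneous M b).
Proof.
split=> [|x y]; rewrite /homogeneous !unfold_in; first by rewrite raddf0.
by move=> /eqP ex /eqP ey; rewrite raddfB /= ex ey.
Qed.
HB.instance Definition _ := GRing.isZmodClosed.Build M
  (homogeneous M b) homogeneous_zmod_closed.
HB.instance Definition _ := [SubChoice_isSubZmodule of component M b by <:].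

Fact component_scaleP (a : k) (x : component M b) :
  a%:MP *: cval x \in homogeneous M b.
Proof. by rewrite unfold_in gprojZ (eqP (cvalP x)). Qed.
Definition component_scale a x := Component (component_scaleP a x).

Fact component_scaleA a c x :
  component_scale a (component_scale c x) = component_scale (a * c) x.
Proof. by apply: val_inj; rewrite /= scalerA mpolyCM. Qed.
Fact component_scale1 : left_id 1 component_scale.
Proof. by move=> x; apply: val_inj; rewrite /= mpolyC1 scale1r. Qed.
Fact component_scaleDr : right_distributive component_scale +%R.
Proof. by move=> a x y; apply: val_inj; rewrite /= scalerDr. Qed.
Fact component_scaleDl x : {morph component_scale^~ x : a c / a + c}.
Proof.
by move=> a c; apply: val_inj; rewrite /= mpolyCD scalerDl.
Qed.
HB.instance Definition _ := GRing.Zmodule_isLmodule.Build k (component M b)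
  component_scaleA component_scale1 component_scaleDr component_scaleDl.

End Component.

Record gradedHom (M N : gradedModule) := GradedHom {
  ghom_fun :> {linear M -> N};
  ghomP : forall b x, ghom_fun (gproj b x) = gproj b (ghom_fun x) }.

Section ComponentMap.
Variables (M N : gradedModule) (f : gradedHom M N) (b : 'X_{1..n}).

Fact component_map_subproof (x : component M b) :
  f (cval x) \in homogeneous N b.
Proof. by rewrite unfold_in -ghomP (eqP (cvalP x)). Qed.
Definition component_map (x : component M b) : component N b :=
  Component (component_map_subproof x).

Fact component_map_linear : linear component_map.
Proof. by move=> a x y; apply: val_inj; rewrite /= linearP. Qed.
HB.instance Definition _ := GRing.isLinear.Build k (component M b)
  (component N b) *:%R component_map component_map_linear.

End ComponentMap.

Record gradedSub (M : gradedModule) := GradedSub {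
  gsub_submod :> submodule M;
  gsub_proj : forall b x, x \in gsub_submod -> gproj b x \in gsub_submod }.

Section SubQuot.
Variables (M : gradedModule) (N : gradedSub M).

Local Notation T := (submod_of N).
Fact gsub_proj_subproof b (x : T) : gproj b (val x) \in submod_pred N.
Proof. exact: gsub_proj (valP x). Qed.
Definition sub_proj b (x : T) : T := SubmodOf (gsub_proj_subproof b x).

Fact sub_projB b : zmod_morphism (sub_proj b).
Proof. by move=> x y; apply: val_inj; rewrite /= !raddfB. Qed.
Fact sub_projK b c x :
  sub_proj b (sub_proj c x) = if b == c then sub_proj c x else 0.
Proof. by apply: val_inj; rewrite /= gprojK; case: ifP. Qed.
Fact sub_proj_sum x : exists s : seq 'X_{1..n},
  uniq s /\ x = \sum_(b <- s) sub_proj b x.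
Proof.
have [s [us e]] := gproj_sum (val x); exists s; split=> //.
by apply: val_inj; rewrite raddf_sum.
Qed.
Fact sub_projM (a : k) m b x :
  sub_proj b ((a *: 'X_[m] : S) *: x) =
  if (m <= b)%MM then (a *: 'X_[m] : S) *: sub_proj (b - m)%MM x else 0.
Proof. by apply: val_inj; rewrite /= gprojM; case: ifP. Qed.
Definition gsub : gradedModule :=
  GradedModule sub_projB sub_projK sub_proj_sum sub_projM.

Local Notation Q := (quot_of N).
Definition quot_proj b (x : Q) : Q := \pi_Q (gproj b (repr x)).
Lemma pi_proj b (x : M) : quot_proj b (\pi_Q x) = \pi_Q (gproj b x).
Proof.
apply/quot_eqP; rewrite -raddfB; apply: gsub_proj.
by apply/quot_eqP; rewrite reprK.
Qed.

Fact quot_projB b : zmod_morphism (quot_proj b).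
Proof.
elim/quot_ind => x; elim/quot_ind => y.
by rewrite -raddfB !pi_proj -!raddfB.
Qed.
Fact quot_projK b c x :
  quot_proj b (quot_proj c x) = if b == c then quot_proj c x else 0.
Proof.
by elim/quot_ind: x => x; rewrite !pi_proj gprojK; case: ifP; rewrite ?raddf0.
Qed.
Fact quot_proj_sum x : exists s : seq 'X_{1..n},
  uniq s /\ x = \sum_(b <- s) quot_proj b x.
Proof.
elim/quot_ind: x => x; have [s [us e]] := gproj_sum x; exists s; split=> //.
rewrite {1}e raddf_sum; apply: eq_bigr => b _; exact/esym/pi_proj.
Qed.
Fact quot_projM (a : k) m b x :
  quot_proj b ((a *: 'X_[m] : S) *: x) =
  if (m <= b)%MM then (a *: 'X_[m] : S) *: quot_proj (b - m)%MM x else 0.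
Proof.
elim/quot_ind: x => x; rewrite -linearZ /= !pi_proj gprojM; case: ifP => _.
  exact: linearZ.
exact: raddf0.
Qed.
Definition gquot : gradedModule :=
  GradedModule quot_projB quot_projK quot_proj_sum quot_projM.

End SubQuot.

Section Homology.

Section KernelImage.
Variables (M N : gradedModule) (f : gradedHom M N).

Definition ker_pred : {pred M} := fun x => f x == 0.
Fact ker_closed : submod_closed ker_pred.
Proof.
split=> [|a x y]; rewrite /ker_pred !unfold_in; first by rewrite raddf0.
by move=> /eqP ex /eqP ey; rewrite linearP ex ey scaler0 addr0.
Qed.
Fact ker_proj b x : x \in ker_pred -> gproj b x \in ker_pred.
Proof. by rewrite !unfold_in ghomP => /eqP ->; rewrite raddf0. Qed.
Definition gker : gradedSub M :=
  @GradedSub M (Submodule ker_closed) ker_proj.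

Definition im_pred : {pred N} := fun y => `[< exists x, f x = y >].
Fact im_closed : submod_closed im_pred.
Proof.
split=> [|a x y]; rewrite /im_pred !unfold_in.
  by apply/asboolP; exists 0; rewrite raddf0.
move=> /asboolP [x' <-] /asboolP [y' <-]; apply/asboolP.
by exists (a *: x' + y'); rewrite linearP.
Qed.
Fact im_proj b y : y \in im_pred -> gproj b y \in im_pred.
Proof.
rewrite !unfold_in => /asboolP [x <-]; apply/asboolP.
by exists (gproj b x); rewrite ghomP.
Qed.
Definition gim : gradedSub N := @GradedSub N (Submodule im_closed) im_proj.

End KernelImage.

Section Boundaries.
Variables (L M N : gradedModule) (f : gradedHom L M) (g : gradedHom M N).

(* the elements of ker g that lie in the image of f *)
Definition boundary_pred : {pred gsub (gker g)} :=
  fun z => submod_val z \in submod_pred (gim f).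
Fact boundary_closed : submod_closed boundary_pred.
Proof.
split=> [|a x y]; first exact: (submod_closedP (gim f)).1.
exact: (submod_closedP (gim f)).2.
Qed.
Fact boundary_proj b z : z \in boundary_pred -> gproj b z \in boundary_pred.
Proof. exact: gsub_proj. Qed.
Definition boundaries : gradedSub (gsub (gker g)) :=
  @GradedSub (gsub (gker g)) (Submodule boundary_closed) boundary_proj.

(* ker g / im f; this is meaningful when g \o f = 0 *)
Definition homology : gradedModule := gquot boundaries.

Definition hclass (z : gsub (gker g)) : homology := \pi_(quot_of boundaries) z.

End Boundaries.

Section HomologyMap.
Variables (L M N L' M' N' : gradedModule).
Variables (f : gradedHom L M) (g : gradedHom M N).
Variables (f' : gradedHom L' M') (g' : gradedHom M' N').
Variable h : gradedHom M M'.
Hypothesis h_ker : forall x, g x = 0 -> g' (h x) = 0.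
Hypothesis h_im : forall x, exists y, h (f x) = f' y.

Fact cycle_map_subproof (z : gsub (gker g)) :
  h (submod_val z) \in submod_pred (gker g').
Proof. by apply/eqP/h_ker; apply/eqP; exact: (submod_valP z). Qed.
Definition cycle_map (z : gsub (gker g)) : gsub (gker g') :=
  SubmodOf (cycle_map_subproof z).

Definition homology_map_fun (x : homology f g) : homology f' g' :=
  hclass f' (cycle_map (repr (x : quot_of (boundaries f g)))).

Lemma homology_map_class z :
  homology_map_fun (hclass f z) = hclass f' (cycle_map z).
Proof.
apply/quot_eqP; rewrite unfold_in.
have : repr (hclass f z : quot_of (boundaries f g)) - z
    \in submod_pred (boundaries f g).
  by apply/quot_eqP; rewrite reprK.
rewrite unfold_in => /asboolP [x ex]; have [y ey] := h_im x.
apply/asboolP; exists y; rewrite -ey ex.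
by rewrite !raddfB.
Qed.

Fact homology_map_linear : linear homology_map_fun.
Proof.
move=> a; elim/quot_ind => x; elim/quot_ind => y.
rewrite -linearP -!/(hclass _ _) !homology_map_class -linearP /=.
by congr (\pi _); apply: val_inj; rewrite /= linearP.
Qed.
HB.instance Definition _ := GRing.isLinear.Build S (homology f g)
  (homology f' g') *:%R homology_map_fun homology_map_linear.

Fact homology_mapP b x :
  homology_map_fun (gproj b x) = gproj b (homology_map_fun x).
Proof.
elim/quot_ind: x => x; rewrite /= pi_proj -!/(hclass _ _) !homology_map_class.
rewrite /= pi_proj; congr (\pi _); apply: val_inj => /=; exact: ghomP.
Qed.
Definition homology_map : gradedHom (homology f g) (homology f' g') :=
  @GradedHom (homology f g) (homology f' g') homology_map_fun homology_mapP.

End HomologyMap.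
End Homology.

Section Support.
Variable M : gradedModule.

Lemma gproj_supp (x : M) :
  exists s : seq 'X_{1..n}, forall b, b \notin s -> gproj b x = 0.
Proof.
have [s [us ex]] := gproj_sum x; exists s => b bs.
rewrite ex raddf_sum big_seq big1 // => c cs /=.
by rewrite gprojK; case: eqP => // e; rewrite -e (negbTE bs) in cs.
Qed.

Lemma gproj_sum_supp (x : M) (s : seq 'X_{1..n}) :
  uniq s -> (forall b, b \notin s -> gproj b x = 0) ->
  x = \sum_(b <- s) gproj b x.
Proof.
move=> us h; have [t [ut ex]] := gproj_sum x.
rewrite {1}ex (bigID (mem s)) /= [X in _ + X]big1 ?addr0; last exact: h.
rewrite [RHS](bigID (mem t)) /= [X in _ + X]big1 ?addr0.
  rewrite -big_filter -[RHS]big_filter; apply: perm_big; apply: uniq_perm.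
  - exact: filter_uniq.
  - exact: filter_uniq.
  - by move=> b; rewrite !mem_filter andbC.
move=> b bt; rewrite ex raddf_sum big_seq big1 // => c cs /=.
by rewrite gprojK; case: eqP => // e; rewrite -e (negbTE bt) in cs.
Qed.

End Support.

(* S as a graded module over itself *)
Definition poly_proj (b : 'X_{1..n}) (p : S^o) : S^o := p@_b *: 'X_[b] : S.

Fact poly_projB b : zmod_morphism (poly_proj b).
Proof. by move=> p q; rewrite /poly_proj mcoeffB scalerBl. Qed.
Fact poly_projK b c p :
  poly_proj b (poly_proj c p) = if b == c then poly_proj c p else 0.
Proof.
rewrite /poly_proj mcoeffZ mcoeffX eq_sym.
by case: eqP => [->|_]; rewrite ?mulr1 // mulr0 scale0r.
Qed.
Fact poly_proj_sum p : exists s : seq 'X_{1..n},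
  uniq s /\ p = \sum_(b <- s) poly_proj b p.
Proof. by exists (msupp p); split; [exact: msupp_uniq | exact: mpolyE]. Qed.
Fact poly_projM (a : k) m b (p : S^o) :
  poly_proj b ((a *: 'X_[m] : S) *: p) =
  if (m <= b)%MM then (a *: 'X_[m] : S) *: poly_proj (b - m)%MM p else 0.
Proof.
have e : (a *: 'X_[m] : S) *: p = a *: ((p : S) * 'X_[m]) :> S.
  by rewrite commr_mpolyX scalerAl.
rewrite /poly_proj e mcoeffZ; case: ifP => hm.
  rewrite -{1 2}(submK hm) addmC mcoeffMX -scalerA.
  transitivity (a *: ('X_[m] * (p@_(b - m)%MM *: 'X_[b - m])) : S).
    by rewrite -scalerAr -mpolyXD addmC.
  by rewrite scalerAl.
rewrite [X in a * X](_ : _ = 0) ?mulr0 ?scale0r //.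
apply/eqP; rewrite mcoeff_eq0 (perm_mem (msuppMX _ _)).
apply/mapP => -[c _ ec]; move: hm; rewrite ec.
by rewrite lem_addr.
Qed.
Definition polyModule : gradedModule :=
  GradedModule poly_projB poly_projK poly_proj_sum poly_projM.

(* the ideal generated by the monomials X^(g i) *)
Section MonomialIdeal.
Variables (I : finType) (g : I -> 'X_{1..n}).

Definition monIdeal_pred : {pred polyModule} := fun p : S =>
  `[< exists c : I -> S, p = \sum_i c i * 'X_[g i] >].
Fact monIdeal_closed : submod_closed monIdeal_pred.
Proof.
split=> [|a p q]; rewrite !unfold_in.
  by apply/asboolP; exists (fun=> 0); rewrite big1 // => i; rewrite mul0r.
move=> /asboolP [c ->] /asboolP [d ->]; apply/asboolP.
exists (fun i => a * c i + d i).
rewrite /GRing.scale /= mulr_sumr -big_split; apply: eq_bigr => i _ /=.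
by rewrite mulrDl mulrA.
Qed.
Fact monIdeal_proj b p :
  p \in monIdeal_pred -> gproj b p \in monIdeal_pred.
Proof.
rewrite !unfold_in => /asboolP [c ->]; apply/asboolP.
exists (fun i => if (g i <= b)%MM then poly_proj (b - g i)%MM (c i) else 0).
rewrite raddf_sum; apply: eq_bigr => i _ /=.
have := poly_projM 1 (g i) b (c i); rewrite scale1r.
rewrite /GRing.scale /= mulrC => ->.
by case: ifP; rewrite ?mul0r // mulrC.
Qed.
Definition monIdeal : gradedSub polyModule :=
  @GradedSub polyModule (Submodule monIdeal_closed) monIdeal_proj.

End MonomialIdeal.

(* M (x) F for F = \bigoplus_(a : I) S(- dg a) free on I, where the basis
   element a has degree dg a; it is identified with M^I *)
Section FreeModule.
Variables (I : finType) (dg : I -> 'X_{1..n}) (M : gradedModule).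

Definition free_proj b (u : {ffun I -> M}) : {ffun I -> M} :=
  [ffun a => if (dg a <= b)%MM then gproj (b - dg a)%MM (u a) else 0].

Fact free_projB b : zmod_morphism (free_proj b).
Proof.
move=> u v; apply/ffunP=> a; rewrite !ffunE.
by case: ifP; rewrite ?raddfB ?subr0.
Qed.
Fact free_projK b c u :
  free_proj b (free_proj c u) = if b == c then free_proj c u else 0.
Proof.
apply/ffunP=> a; rewrite !ffunE (fun_if (fun v : {ffun I -> M} => v a)) !ffunE.
case: (boolP (dg a <= c)%MM) => hc; last by rewrite raddf0 !if_same.
case: (boolP (dg a <= b)%MM) => hb.
  rewrite gprojK; congr (if _ then _ else _).
  apply/eqP/eqP => [e|->//].
  by rewrite -(submK hb) -(submK hc) e.
by case: eqP => // e; rewrite e hc in hb.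
Qed.
Fact free_proj_sum u : exists s : seq 'X_{1..n},
  uniq s /\ u = \sum_(b <- s) free_proj b u.
Proof.
have [t ht] := choice (fun a : I => gproj_supp (u a)).
pose s := undup (flatten [seq [seq (c + dg a)%MM | c <- t a] | a <- enum I]).
exists s; split; first exact: undup_uniq.
apply/ffunP=> a; rewrite sum_ffunE.
under eq_bigr do rewrite ffunE.
rewrite -big_mkcond -big_filter /=.
rewrite -(big_map (fun b => b - dg a)%MM predT (fun c => gproj c (u a))).
apply: gproj_sum_supp.
  rewrite map_inj_in_uniq ?filter_uniq ?undup_uniq // => b c.
  rewrite !mem_filter => /andP [hb _] /andP [hc _] e.
  by rewrite -(submK hb) -(submK hc) e.
move=> c hc; apply: ht; apply: contra hc => hc.
apply/mapP; exists (c + dg a)%MM; last by rewrite addmK.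
rewrite mem_filter lem_addl mem_undup; apply/flattenP.
exists [seq (c + dg a)%MM | c <- t a]; last exact: map_f.
by apply/mapP; exists a; rewrite ?mem_enum.
Qed.
Fact free_projM (a : k) m b u :
  free_proj b ((a *: 'X_[m] : S) *: u) =
  if (m <= b)%MM then (a *: 'X_[m] : S) *: free_proj (b - m)%MM u else 0.
Proof.
apply/ffunP=> c.
rewrite (fun_if (fun v : {ffun I -> M} => v c)) !ffunE gprojM.
case: (boolP (dg c <= b)%MM) => h1; case: (boolP (m <= b)%MM) => h2.
- have -> : (m <= b - dg c)%MM = (dg c <= b - m)%MM.
    apply/mnm_lepP/mnm_lepP => h i; have := h i; rewrite !mnmBE;
      move/mnm_lepP/(_ i): h1; move/mnm_lepP/(_ i): h2; lia.
  case: ifP => _; last by rewrite scaler0.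
  by congr (_ *: gproj _ _); apply/mnmP => i; rewrite !mnmBE; lia.
- case: (boolP (m <= b - dg c)%MM) => // h3; case/negP: h2.
  by apply: lepm_trans h3 (lem_subr _ _).
- case: (boolP (dg c <= b - m)%MM) => [h3|]; last by rewrite scaler0.
  by case/negP: h1; apply: lepm_trans h3 (lem_subr _ _).
by [].
Qed.
Definition freeModule : gradedModule :=
  GradedModule free_projB free_projK free_proj_sum free_projM.

End FreeModule.

Definition homogeneous_mx (I J : finType) (dI : I -> 'X_{1..n})
    (dJ : J -> 'X_{1..n}) (A : I -> J -> S) : Prop :=
  forall a c m, m \in msupp (A a c) -> (m + dJ c)%MM = dI a.

Section FreeHom.
Variables (I J : finType) (dI : I -> 'X_{1..n}) (dJ : J -> 'X_{1..n}).

(* the degree-preserving map M (x) F -> M (x) F' induced by the S-linear map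
   F -> F' that sends the basis element a to \sum_c A a c * c *)
Section MatrixHom.
Variables (A : I -> J -> S) (hA : homogeneous_mx dI dJ A) (M : gradedModule).

Definition mxhom_fun (u : freeModule dI M) : freeModule dJ M :=
  [ffun c => \sum_a A a c *: u a].

Fact mxhom_linear : linear mxhom_fun.
Proof.
move=> a u v; apply/ffunP=> c; rewrite !ffunE scaler_sumr -big_split.
apply: eq_bigr => i _ /=.
by rewrite !ffunE scalerDr !scalerA mulrC.
Qed.
HB.instance Definition _ := GRing.isLinear.Build S (freeModule dI M)
  (freeModule dJ M) *:%R mxhom_fun mxhom_linear.

Fact mxhomP b u : mxhom_fun (gproj b u) = gproj b (mxhom_fun u).
Proof.
apply/ffunP=> c; rewrite !ffunE /=.
have eA a : A a c = 0 \/ (dJ c <= dI a)%MM /\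
    A a c = (A a c)@_(dI a - dJ c)%MM *: 'X_[dI a - dJ c].
  have [->|nz] := eqVneq (A a c) 0; [by left | right].
  have := @hA a c _ (mlead_supp nz) => e; split.
    by rewrite -e lem_addl.
  apply/mpolyP => m; rewrite mcoeffZ mcoeffX.
  have [hm|hm] := boolP (m \in msupp (A a c)).
    by rewrite -(hA hm) addmK eqxx mulr1.
  rewrite (memN_msupp_eq0 hm); case: eqP => [em|_]; last by rewrite mulr0.
  by rewrite em (memN_msupp_eq0 hm) mul0r.
case: ifP => hb.
  rewrite raddf_sum; apply: eq_bigr => a _ /=; rewrite ffunE.
  case: (eA a) => [->|[h ->]]; first by rewrite !scale0r raddf0.
  rewrite gprojM.
  have -> : (dI a - dJ c <= b - dJ c)%MM = (dI a <= b)%MM.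
    apply/mnm_lepP/mnm_lepP => h' i; have := h' i; rewrite !mnmBE;
      move/mnm_lepP/(_ i): h; move/mnm_lepP/(_ i): hb; lia.
  case: ifP => hab; last by rewrite scaler0.
  congr (_ *: gproj _ _); apply/mnmP=> i; rewrite !mnmBE.
  by move/mnm_lepP/(_ i): h; move/mnm_lepP/(_ i): hb; lia.
rewrite big1 // => a _; rewrite ffunE.
case: (eA a) => [->|[h _]]; first by rewrite scale0r.
case: ifP => hab; last by rewrite scaler0.
by rewrite (lepm_trans h hab) in hb.
Qed.
Definition mxhom : gradedHom (freeModule dI M) (freeModule dJ M) :=
  @GradedHom (freeModule dI M) (freeModule dJ M) mxhom_fun mxhomP.

End MatrixHom.

(* phi (x) F : M (x) F -> N (x) F *)
Section BaseHom.
Variables (M N : gradedModule) (phi : gradedHom M N).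

Definition freemap_fun (u : freeModule dI M) : freeModule dI N :=
  [ffun a => phi (u a)].
Fact freemap_linear : linear freemap_fun.
Proof. by move=> a u v; apply/ffunP=> c; rewrite !ffunE linearP. Qed.
HB.instance Definition _ := GRing.isLinear.Build S (freeModule dI M)
  (freeModule dI N) *:%R freemap_fun freemap_linear.
Fact freemapP b u : freemap_fun (gproj b u) = gproj b (freemap_fun u).
Proof.
by apply/ffunP=> c; rewrite !ffunE; case: ifP; rewrite ?raddf0 ?ghomP.
Qed.
Definition freemap : gradedHom (freeModule dI M) (freeModule dI N) :=
  @GradedHom (freeModule dI M) (freeModule dI N) freemap_fun freemapP.

End BaseHom.
End FreeHom.


(* A complex of N^n-graded free S-modules of finite rank: the j-th term has
   basis [basis j], and the differential sends a in [basis i], i = j + 1, to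
   \sum_c diff i j a c * c.  [diff i j] is unused when i != j + 1; giving it
   two indices avoids casts between [basis j] and [basis (j - 1 + 1)]. *)
Record freeComplex := FreeComplex {
  basis : int -> finType;
  bdeg : forall j, basis j -> 'X_{1..n};
  diff : forall i j, basis i -> basis j -> S;
  diff_homog : forall i j, i = j + 1 ->
    homogeneous_mx (@bdeg i) (@bdeg j) (@diff i j);
  diffK : forall i j l, i = j + 1 -> j = l + 1 ->
    forall (a : basis i) (c : basis l),
      \sum_(b : basis j) @diff i j a b * @diff j l b c = 0 }.
Arguments bdeg : clear implicits.
Arguments diff : clear implicits.

Section Complexes.

Definition tensor (C : freeComplex) (M : gradedModule) (j : int) :=
  freeModule (bdeg C j) M.

Definition tdiff (C : freeComplex) (M : gradedModule) (i j : int)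
    (e : i = j + 1) : gradedHom (tensor C M i) (tensor C M j) :=
  mxhom (@diff_homog C i j e) M.

(* H_j(C (x) M) *)
Definition chomology (C : freeComplex) (M : gradedModule) (j : int) :
    gradedModule :=
  homology (tdiff C M (erefl (j + 1))) (tdiff C M (esym (subrK 1 j))).

Lemma mxhom_comp (I J K : finType) dI dJ dK (A : I -> J -> S) (B : J -> K -> S)
    (hA : homogeneous_mx dI dJ A) (hB : homogeneous_mx dJ dK B) M u c :
  mxhom hB M (mxhom hA M u) c = \sum_a (\sum_b A a b * B b c) *: u a.
Proof.
rewrite ffunE; under eq_bigr => b _ do rewrite ffunE scaler_sumr.
rewrite exchange_big; apply: eq_bigr => a _ /=; rewrite scaler_suml.
by apply: eq_bigr => b _; rewrite scalerA mulrC.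
Qed.

Section CoefficientMap.
Variables (C : freeComplex) (M N : gradedModule) (phi : gradedHom M N).

Lemma tdiff_freemap i j (e : i = j + 1) u :
  tdiff C N e (freemap (bdeg C i) phi u)
    = freemap (bdeg C j) phi (tdiff C M e u).
Proof.
apply/ffunP=> c; rewrite !ffunE raddf_sum; apply: eq_bigr => a _ /=.
by rewrite ffunE linearZ.
Qed.

Fact coef_map_ker j u : tdiff C M (esym (subrK 1 j)) u = 0 ->
  tdiff C N (esym (subrK 1 j)) (freemap (bdeg C j) phi u) = 0.
Proof. by rewrite tdiff_freemap => ->; rewrite raddf0. Qed.
Fact coef_map_im j u : exists v,
  freemap (bdeg C j) phi (tdiff C M (erefl (j + 1)) u)
    = tdiff C N (erefl (j + 1)) v.
Proof. by exists (freemap (bdeg C (j + 1)) phi u); rewrite tdiff_freemap. Qed.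

(* H_j(C (x) M) -> H_j(C (x) N) *)
Definition chomology_coef j : gradedHom (chomology C M j) (chomology C N j) :=
  homology_map (@coef_map_ker j) (@coef_map_im j).

End CoefficientMap.

Record chainMap (C D : freeComplex) := ChainMap {
  cmap : forall j, basis C j -> basis D j -> S;
  cmap_homog : forall j, homogeneous_mx (bdeg C j) (bdeg D j) (@cmap j);
  cmap_diff : forall i j, i = j + 1 -> forall (a : basis C i) (c : basis D j),
    \sum_b diff C i j a b * @cmap j b c = \sum_b @cmap i a b * diff D i j b c }.
Arguments cmap {C D} f j a c : rename.

Section ChainMapHomology.
Variables (C D : freeComplex) (f : chainMap C D) (M : gradedModule).

Definition tmap j : gradedHom (tensor C M j) (tensor D M j) :=
  mxhom (@cmap_homog C D f j) M.

Lemma tdiff_tmap i j (e : i = j + 1) u :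
  tdiff D M e (tmap i u) = tmap j (tdiff C M e u).
Proof.
apply/ffunP=> c; rewrite !mxhom_comp; apply: eq_bigr => a _.
by rewrite cmap_diff.
Qed.

Fact chain_map_ker j u : tdiff C M (esym (subrK 1 j)) u = 0 ->
  tdiff D M (esym (subrK 1 j)) (tmap j u) = 0.
Proof. by rewrite tdiff_tmap => ->; rewrite raddf0. Qed.
Fact chain_map_im j u : exists v,
  tmap j (tdiff C M (erefl (j + 1)) u) = tdiff D M (erefl (j + 1)) v.
Proof. by exists (tmap (j + 1) u); rewrite tdiff_tmap. Qed.

(* H_j(C (x) M) -> H_j(D (x) M) *)
Definition chomology_map j : gradedHom (chomology C M j) (chomology D M j) :=
  homology_map (@chain_map_ker j) (@chain_map_im j).

End ChainMapHomology.
End Complexes.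

(* An N^n-graded resolution of N by free S-modules of finite rank. *)
Record freeResolution (N : gradedModule) := FreeResolution {
  rcomplex :> freeComplex;
  augmentation : gradedHom (tensor rcomplex polyModule 0) N;
  res_neg : forall j, j < 0 -> #|basis rcomplex j| = 0%N;
  res_surj : forall y, exists u, augmentation u = y;
  res_exact0 : forall e u, augmentation u = 0 <->
    exists v, @tdiff rcomplex polyModule 1 0 e v = u;
  res_exact : forall i j l (eij : i = j + 1) (ejl : j = l + 1), 0 < j ->
    forall u, tdiff rcomplex polyModule ejl u = 0 <->
      exists v, tdiff rcomplex polyModule eij v = u }.

(* Tor_j^S(N, M) = H_j(F (x) M) for a resolution F of N.  As j is an integer and
   F_j = 0 for j < 0, it vanishes in negative homological degree. *)
Definition Tor (N : gradedModule) (F : freeResolution N) (j : int)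
  (M : gradedModule) : gradedModule := chomology F M j.

Definition Tor_map (N : gradedModule) (F : freeResolution N) (j : int)
  (M M' : gradedModule) (phi : gradedHom M M') :
  gradedHom (Tor F j M) (Tor F j M') := chomology_coef F phi j.

(* k = S / (x_1, ..., x_n) *)
Definition residueField : gradedModule :=
  gquot (monIdeal (fun i : 'I_n => U_(i)%MM)).

End GradedModules.

Record simplicialComplex (n : nat) := SimplicialComplex {
  faces :> {set {set 'I_n}};
  faces_sub : forall J K : {set 'I_n}, K \subset J -> J \in faces -> K \in faces;
  faces0 : set0 \in faces;
  faces1 : forall i, [set i] \in faces }.

Section Simplicial.
Variables (k : fieldType) (n : nat).
Local Notation S := {mpoly k[n]}.
Implicit Types (Delta : simplicialComplex n) (J K : {set 'I_n}).

(* the exponent of the monomial x_J *)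
Definition setmnm J : 'X_{1..n} := [multinom nat_of_bool (i \in J) | i < n].

Definition nonface Delta := {J : {set 'I_n} | J \notin faces Delta}.

Definition SRideal Delta : gradedSub (polyModule k n) :=
  monIdeal k (fun J : nonface Delta => setmnm (val J)).

Definition stanleyReisner Delta : gradedModule k n := gquot (SRideal Delta).

(* the coefficient of v_K in the Koszul differential of v_J: if v is the r-th
   element of J then r - 1 = #|{l in J, l < v}| *)
Definition koszul_coef J K : S :=
  \sum_(v in J | J :\ v == K) (-1) ^+ #|[set l in J | (l < v)%N]| * 'X_v.

(* v_(j_1) /\ ... /\ v_(j_i) with j_1 < ... < j_i is indexed by the set
   {j_1, ..., j_i} *)
Definition face Delta (j : int) :=
  {J : {set 'I_n} | (J \in faces Delta) && (#|J|%:Z == j)}.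

Definition face_deg Delta j (J : face Delta j) : 'X_{1..n} := setmnm (val J).

Lemma big_face Delta j (F : {set 'I_n} -> S) :
  (forall K, F K != 0 -> (K \in faces Delta) && (#|K|%:Z == j)) ->
  \sum_(K : face Delta j) F (val K) = \sum_K F K.
Proof.
move=> h; rewrite [RHS](bigID (fun K => (K \in faces Delta) && (#|K|%:Z == j))).
rewrite /= [X in _ + X]big1 ?addr0; last first.
  by move=> K hK; apply/eqP; apply: contraR hK; exact: h.
rewrite (reindex_omap (val : face Delta j -> _) insub) /=; last first.
  by move=> K hK; rewrite insubT.
by apply: eq_bigl => K; rewrite valK (valP K) eqxx.
Qed.

Definition koszul_diff Delta i j (J : face Delta i) (K : face Delta j) : S :=
  koszul_coef (val J) (val K).

Lemma koszul_coefD1 J v : v \in J ->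
  koszul_coef J (J :\ v) = (-1) ^+ #|[set l in J | (l < v)%N]| * 'X_v.
Proof.
move=> vJ; rewrite /koszul_coef (big_pred1 v) // => w.
apply/andP/eqP => [[wJ /eqP e]|->]; last by rewrite vJ eqxx.
apply/eqP; apply: contraTT wJ => ne.
have : w \notin J :\ v by rewrite -e !inE eqxx.
by rewrite !inE ne.
Qed.

Lemma koszul_coef_eq0 J K :
  (forall v, v \in J -> J :\ v != K) -> koszul_coef J K = 0.
Proof.
move=> h; rewrite /koszul_coef big_pred0 // => v.
by apply/negbTE/negP => /andP [/h /negbTE ->].
Qed.

Variant koszul_coef_spec J K : S -> Type :=
| KoszulCoef0 : koszul_coef_spec J K 0
| KoszulCoef v of v \in J & K = J :\ v :
    koszul_coef_spec J K ((-1) ^+ #|[set l in J | (l < v)%N]| * 'X_v).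

Lemma koszul_coefP J K : koszul_coef_spec J K (koszul_coef J K).
Proof.
have [/existsP /sigW [v /andP [vJ /eqP e]] | h] :=
    boolP [exists v, (v \in J) && (J :\ v == K)].
  by rewrite -e koszul_coefD1 //; constructor.
rewrite koszul_coef_eq0; first by constructor.
move=> v vJ; apply: contra h => h.
by apply/existsP; exists v; rewrite vJ.
Qed.

Fact koszul_diff_homog Delta i j : i = j + 1 ->
  homogeneous_mx (@face_deg Delta i) (@face_deg Delta j)
    (@koszul_diff Delta i j).
Proof.
rewrite /koszul_diff.
move=> _ J K m; case: koszul_coefP => [|v vJ e].
  by rewrite msupp0.
rewrite mcoeff_msupp -signr_odd mulr_sign.
have -> : (if odd #|[set l in val J | (l < v)%N]| then - 'X_v else 'X_v : S)@_m
    != 0 = (U_(v)%MM == m).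
  case: (odd _); rewrite ?mcoeffN ?oppr_eq0 mcoeffX;
    by case: (_ == m); rewrite ?oner_eq0 ?eqxx.
move=> /eqP <-; apply/mnmP => l.
rewrite mnmDE mnm1E !mnmE e !inE [l == v]eq_sym.
by case: eqP => [<-|_] //=; rewrite vJ.
Qed.

Lemma sum_antisym (G : 'I_n -> 'I_n -> S) : (forall v, G v v = 0) ->
  (forall v w : 'I_n, (v < w)%N -> G v w = - G w v) -> \sum_v \sum_w G v w = 0.
Proof.
move=> G0 GN.
have split (v : 'I_n) : \sum_w G v w =
    \sum_(w < n) (if (v < w)%N then G v w else 0)
    + \sum_(w < n) (if (w < v)%N then G v w else 0).
  rewrite -big_split; apply: eq_bigr => w _ /=.
  by case: ltngtP => h; rewrite ?addr0 ?add0r // (ord_inj h) G0.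
under eq_bigr do rewrite split; rewrite big_split /=.
rewrite [X in _ + X]exchange_big -big_split big1 // => v _ /=.
rewrite -big_split big1 // => w _ /=.
by case: ifP => h; rewrite ?addr0 // GN // addNr.
Qed.

Lemma koszul_coef_comp J K :
  \sum_(v in J) koszul_coef J (J :\ v) * koszul_coef (J :\ v) K = 0.
Proof.
pose T (I : {set 'I_n}) (v : 'I_n) : S := (-1) ^+ #|[set l in I | (l < v)%N]| * 'X_v.
pose G v w := if [&& v \in J, w \in J :\ v & J :\ v :\ w == K]
              then T J v * T (J :\ v) w else 0.
rewrite -[RHS](sum_antisym (G := G)).
- rewrite big_mkcond; apply: eq_bigr => v _; rewrite /G.
  case: ifP => vJ /=; last by rewrite big1.
  rewrite koszul_coefD1 // /koszul_coef mulr_sumr big_mkcond.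
  by apply: eq_bigr.
- by move=> v; rewrite /G !inE eqxx andbF.
move=> v w vw; rewrite /G.
have nvw : (w == v) = false by apply/eqP => e; rewrite e ltnn in vw.
have e : J :\ v :\ w = J :\ w :\ v.
  by apply/setP=> l; rewrite !inE; do 2?case: (l == _).
rewrite e !inE nvw [v == w]eq_sym nvw /=.
case: (boolP (v \in J)) => vJ; case: (boolP (w \in J)) => wJ /=;
  rewrite ?oppr0 //; case: ifP; rewrite ?oppr0 // => _.
rewrite /T.
have -> : [set l in J :\ w | (l < v)%N] = [set l in J | (l < v)%N].
  apply/setP=> l; rewrite !inE; case: (l =P w) => [->|//] /=.
  by rewrite ltnNge ltnW // andbF.
have -> : #|[set l in J | (l < w)%N]| = #|[set l in J :\ v | (l < w)%N]|.+1.
  rewrite (cardsD1 v) !inE vJ vw add1n; congr _.+1; apply: eq_card => l.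
  by rewrite !inE andbA.
by rewrite exprS; ring.
Qed.

Fact koszul_diffK Delta i j l : i = j + 1 -> j = l + 1 ->
  forall (J : face Delta i) (L : face Delta l),
    \sum_(K : face Delta j) koszul_diff J K * koszul_diff K L = 0.
Proof.
move=> eij _ J L; rewrite -[RHS](koszul_coef_comp (val J) (val L)).
have /andP [JD /eqP Jc] := valP J.
have faceD1 v : v \in val J ->
    (val J :\ v \in faces Delta) && (#|val J :\ v|%:Z == j).
  move=> vJ; rewrite (faces_sub _ JD) ?subD1set //=.
  apply/eqP/(@addIr _ (1 : int)).
  apply: etrans eij; apply: etrans Jc.
  by rewrite (cardsD1 v (val J)) vJ PoszD addrC.
rewrite (big_face (F := fun K => koszul_coef (val J) K
                                * koszul_coef K (val L))).
  transitivity (\sum_K \sum_(v in val J) if val J :\ v == K then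
      koszul_coef (val J) K * koszul_coef K (val L) else 0).
    apply: eq_bigr => K _; case: (koszul_coefP (val J) K) => [|v vJ ->].
      by rewrite mul0r big1 // => v _; rewrite if_same.
    rewrite (bigD1 v) //= eqxx big1 ?addr0 // => w /andP [wJ ne].
    case: eqP => // /setP /(_ w); rewrite !inE eqxx wJ /= andbT.
    by rewrite ne.
  rewrite exchange_big; apply: eq_bigr => v vJ /=.
  by rewrite -big_mkcond (big_pred1 (val J :\ v)) // => K; rewrite eq_sym.
move=> K; case: koszul_coefP => [|v vJ -> _]; first by rewrite mul0r eqxx.
exact: faceD1.
Qed.

(* the subcomplex K^Delta of the Koszul complex *)
Definition koszulComplex Delta : freeComplex k n :=
  FreeComplex (@koszul_diff_homog Delta) (@koszul_diffK Delta).

(* W_i(Delta) *)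
Definition koszulModule Delta (i : int) : gradedModule k n :=
  chomology (koszulComplex Delta) (polyModule k n) i.

Section Inclusion.
Variables (Delta Delta' : simplicialComplex n).
Hypothesis sub : faces Delta \subset faces Delta'.

Definition face_incl j (J : face Delta j) (K : face Delta' j) : S :=
  (val J == val K)%:R.

Fact face_incl_homog j : homogeneous_mx (@face_deg Delta j)
  (@face_deg Delta' j) (@face_incl j).
Proof.
move=> J K m; rewrite /face_incl /face_deg; case: eqP => [->|_].
  by rewrite msupp1 inE => /eqP ->; rewrite add0m.
by rewrite msupp0.
Qed.

Fact face_incl_diff i j : i = j + 1 ->
  forall (J : face Delta i) (L : face Delta' j),
  \sum_(K : face Delta j) koszul_diff J K * face_incl K L
    = \sum_(K : face Delta' i) face_incl J K * koszul_diff K L.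
Proof.
move=> eij J L; have /andP [JD /eqP Jc] := valP J.
have J' : (val J \in faces Delta') && (#|val J|%:Z == i).
  by rewrite (subsetP sub) ?Jc /=.
rewrite [RHS](bigD1 (exist _ (val J) J' : face Delta' i)) //=.
rewrite [X in _ = _ + X]big1 => [|K ne]; last first.
  rewrite /face_incl -(inj_eq val_inj) /= in ne *.
  by rewrite eq_sym (negbTE ne) mul0r.
rewrite addr0 /face_incl eqxx mul1r /koszul_diff /=.
have [LD|LD] := boolP (val L \in faces Delta).
  have L' : (val L \in faces Delta) && (#|val L|%:Z == j).
    by have /andP [_ ->] := valP L; rewrite LD.
  rewrite (bigD1 (exist _ (val L) L' : face Delta j)) //= eqxx mulr1.
  rewrite big1 ?addr0 // => K ne.
  by rewrite -(inj_eq val_inj) /= in ne; rewrite (negbTE ne) mulr0.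
rewrite big1 => [|K _].
  apply/esym/koszul_coef_eq0 => v vJ; apply/eqP => e; case/negP: LD.
  by apply: faces_sub JD; have := subD1set (val J) v; rewrite e.
case: eqP => [e|_]; last by rewrite mulr0.
have KD : sval K \in faces Delta by case/andP: (valP K).
by case/negP: LD; rewrite -[val L](e : sval K = sval L).
Qed.

Definition koszul_incl : chainMap (koszulComplex Delta) (koszulComplex Delta') :=
  @ChainMap k n (koszulComplex Delta) (koszulComplex Delta')
    face_incl face_incl_homog face_incl_diff.

(* W_i(Delta) -> W_i(Delta') *)
Definition koszulModule_map i :
    gradedHom (koszulModule Delta i) (koszulModule Delta' i) :=
  chomology_map koszul_incl (polyModule k n) i.

Fact SRideal_sub (p : polyModule k n) :
  p \in submod_pred (SRideal Delta') -> p \in submod_pred (SRideal Delta).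
Proof.
rewrite !unfold_in => /asboolP [c ->]; apply/asboolP.
have incl (J : nonface Delta') : val J \notin faces Delta.
  by apply: contra (valP J); exact: (subsetP sub).
pose h (J : nonface Delta') : nonface Delta := exist _ (val J) (incl J).
exists (fun J : nonface Delta => \sum_(K : nonface Delta' | h K == J) c K).
rewrite (partition_big h predT) //=; apply: eq_bigr => J _.
by rewrite mulr_suml; apply: eq_bigr => K /eqP <-.
Qed.

Definition SR_proj_fun (x : stanleyReisner Delta') : stanleyReisner Delta :=
  \pi_(quot_of (SRideal Delta)) (repr (x : quot_of (SRideal Delta'))).

Lemma SR_proj_pi (p : polyModule k n) :
  SR_proj_fun (\pi_(quot_of (SRideal Delta')) p)
    = \pi_(quot_of (SRideal Delta)) p.
Proof. by apply/quot_eqP/SRideal_sub/quot_eqP; rewrite reprK. Qed.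

Fact SR_proj_linear : linear SR_proj_fun.
Proof.
move=> a; elim/quot_ind => x; elim/quot_ind => y.
by rewrite -linearP !SR_proj_pi linearP.
Qed.
HB.instance Definition _ := GRing.isLinear.Build S (stanleyReisner Delta')
  (stanleyReisner Delta) *:%R SR_proj_fun SR_proj_linear.

Fact SR_projP b x : SR_proj_fun (gproj b x) = gproj b (SR_proj_fun x).
Proof. by elim/quot_ind: x => x; rewrite /= pi_proj !SR_proj_pi pi_proj. Qed.

(* the surjection k[Delta'] -> k[Delta] *)
Definition SR_proj : gradedHom (stanleyReisner Delta') (stanleyReisner Delta) :=
  @GradedHom k n (stanleyReisner Delta') (stanleyReisner Delta)
    SR_proj_fun SR_projP.

End Inclusion.

End Simplicial.

(* Main.v *)
From HB Require Import structures.
Require Import Defs.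
From mathcomp Require Import all_boot all_order all_algebra.
From mathcomp Require Import ring_quotient generic_quotient.
From mathcomp Require Import mpoly.
From mathcomp Require Import boolp.
From mathcomp Require Import zify ring.

Set Implicit Arguments.
Unset Strict Implicit.
Unset Printing Implicit Defensive.

Import GRing.Theory.
Local Open Scope ring_scope.
Local Open Scope quotient_scope.

(** Fix a squarefree degree b with support B, and put q = |b| - i.

    In degree b a chain of the complex K^Delta in homological degree i is a
    combination of the x^(b - e_J) v_J, where J is a face of Delta with i
    elements contained in B: this is the augmented chain complex of the
    restriction of Delta to B.  If Tor is computed by the Koszul resolution K of
    the residue field, a chain of K (x) k[Delta] in homological degree q and
    degree b is a combination of the v_L (x) x_J with J, L disjoint and of union
    B, and it vanishes unless J is a face; here J also has i elements.
    Removing a vertex v from L adds it to J, so that this complex is the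
    augmented cochain complex of the same restriction.  The Koszul sign of v in
    L times that of v in J is the sign given by the number of elements of B
    below v; it does not depend on J and can be absorbed in the basis
    ([dual_sign]).  Then [pairing] makes the two differentials adjoint
    ([pairing_adjoint]), and finite-dimensional duality says that cycles of one
    complex modulo boundaries are the functionals on the homology of the other
    ([pairing_separates], [pairing_represents]).

    The resolution F that defines Tor is arbitrary, so K must be compared with
    F.  This needs two facts.  First, two resolutions of the same module by free
    modules admit chain maps f and g in both directions whose composites are
    homotopic to the identity after tensoring with any module
    ([comparison]).  Secondly, K is a resolution of the residue field
    ([koszulResolution]); in a degree b != 0 it is the augmented chain complex
    of a full simplex, and the cone over the least vertex of the support of b
    contracts it ([koszul_exact_degree]).

    The isomorphism sends the class of z to the functional
    t |-> pairing z (f t) ([tor_dual]).  One f serves all Delta, and chains and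
    cochains of Delta are those of a larger complex restricted to the faces of
    Delta, whence the naturality in Delta ([tor_dual_natural]). *)

Local Notation basis := Defs.basis.
Local Arguments bdeg {k n} f j.
Local Arguments diff {k n} f i j.
Local Arguments res_exact0 {k n N} f e u.
Local Arguments res_exact {k n N} f {i j l} eij ejl _ u.
Local Arguments res_surj {k n N} f y.
Local Arguments res_neg {k n N} f {j} _.
Local Arguments augmentation {k n N} f.
Local Arguments cmap {k n C D} f j a c : rename.

(** * The homology relation on chains *)
Section Homologous.
Variables (k : fieldType) (n : nat).
Local Notation S := {mpoly k[n]}.

Lemma ghom_lin (M N : gradedModule k n) (f : gradedHom M N) (p : S) x y :
  f (p *: x + y) = p *: f x + f y.
Proof. exact: linearP. Qed.

Lemma homog_lin (M : gradedModule k n) b (a : k) (x y : M) :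
  gproj b x = x -> gproj b y = y -> gproj b (a%:MP *: x + y) = a%:MP *: x + y.
Proof.
move=> hx hy; have e := gprojZ a b x; rewrite hx in e.
by rewrite -[in RHS]e -[in RHS]hy; apply: raddfD.
Qed.

(** Working with this relation on chains, instead of with homology classes,
    allows a representative to be changed inside an expression. *)
Definition homologous (L M : gradedModule k n) (d : gradedHom L M) (x y : M) :=
  exists v, d v = x - y.

Section Rel.
Variables (L M : gradedModule k n) (d : gradedHom L M).
Implicit Types x y z : M.

Lemma homologous_sym x y : homologous d x y -> homologous d y x.
Proof. by case=> v ev; exists (- v); rewrite raddfN /= ev opprB. Qed.

Lemma homologous_trans y x z :
  homologous d x y -> homologous d y z -> homologous d x z.
Proof.
by case=> v ev [w ew]; exists (v + w); rewrite raddfD /= ev ew addrA subrK.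
Qed.

Lemma homologous_lin (p : S) x y x' y' : homologous d x x' -> homologous d y y' ->
  homologous d (p *: x + y) (p *: x' + y').
Proof.
case=> v ev [w ew]; exists (p *: v + w); rewrite linearP /= ev ew.
by rewrite opprD addrACA scalerBr.
Qed.

End Rel.

Lemma homologous_map (L M L' M' : gradedModule k n) (d : gradedHom L M)
    (d' : gradedHom L' M') (h : gradedHom M M') (h' : gradedHom L L') x y :
  (forall v, d' (h' v) = h (d v)) ->
  homologous d x y -> homologous d' (h x) (h y).
Proof. by move=> e [v ev]; exists (h' v); rewrite e ev raddfB. Qed.

End Homologous.

(** * Comparison of free resolutions *)

Section Comparison.
Variables (k : fieldType) (n : nat).
Local Notation S := {mpoly k[n]}.
Local Notation P := (polyModule k n).
Implicit Types (M N : gradedModule k n).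

Lemma gproj_sub M b (x y : M) : gproj b (x - y) = gproj b x - gproj b y.
Proof. exact: raddfB. Qed.

Lemma ghom_sub M N (f : gradedHom M N) (x y : M) : f (x - y) = f x - f y.
Proof. exact: raddfB. Qed.

Lemma homog_sub M b (x y : M) :
  gproj b x = x -> gproj b y = y -> gproj b (x - y) = x - y.
Proof. by move=> ex ey; rewrite gproj_sub ex ey. Qed.

Lemma ghom_sub0 M N (f : gradedHom M N) (x y : M) : f x = f y -> f (x - y) = 0.
Proof. by rewrite ghom_sub => ->; rewrite subrr. Qed.

Lemma ghom_subsub0 M N (f : gradedHom M N) (x y z : M) x' y' :
  f x = x' -> f y = y' -> f z = x' - y' -> f (x - y - z) = 0.
Proof. by rewrite !ghom_sub => -> -> ->; rewrite subrr. Qed.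

Section Rows.
Variables (I : finType) (dI : I -> 'X_{1..n}).

Definition basis_elt (a : I) : freeModule dI P := [ffun c => (c == a)%:R : S].

Lemma basis_elt_homog a : gproj (dI a) (basis_elt a) = basis_elt a.
Proof.
apply/ffunP=> c; rewrite !ffunE; case: eqP => [->|_]; last first.
  by rewrite raddf0 if_same.
rewrite lepm_refl /= /poly_proj.
have -> : (dI a - dI a)%MM = 0%MM by apply/mnmP=> l; rewrite mnmBE subnn mnmE.
by rewrite mcoeff1 eqxx scale1r mpolyX0.
Qed.

Definition mxrow_elt (J : finType) (dJ : J -> 'X_{1..n}) (A : I -> J -> S) a :
  freeModule dJ P := [ffun c => A a c].

Lemma mxhom_basis (J : finType) (dJ : J -> 'X_{1..n}) (A : I -> J -> S)
    (hA : homogeneous_mx dI dJ A) a :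
  mxhom hA P (basis_elt a) = mxrow_elt dJ A a.
Proof.
apply/ffunP=> c; rewrite !ffunE (bigD1 a) //= ffunE eqxx.
rewrite big1 => [|a' ne]; first by rewrite /GRing.scale /= mulr1 addr0.
by rewrite ffunE (negbTE ne) scaler0.
Qed.

Lemma ghom_basis_homog M (f : gradedHom (freeModule dI P) M) a :
  gproj (dI a) (f (basis_elt a)) = f (basis_elt a).
Proof. by rewrite -ghomP basis_elt_homog. Qed.

(** Graded free modules are projective.  Any preimage v of u a can be replaced by
    its component of degree dI a, and the entries of a homogeneous vector have
    the degrees that a homogeneous matrix requires. *)
Lemma lift_homogeneous (J : finType) (dJ : J -> 'X_{1..n}) M
    (d : gradedHom (freeModule dJ P) M) (u : I -> M) :
  (forall a, gproj (dI a) (u a) = u a) -> (forall a, exists v, d v = u a) ->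
  exists A (hA : homogeneous_mx dI dJ A), forall a, d (mxrow_elt dJ A a) = u a.
Proof.
move=> hu /choice [v hv].
pose w a := gproj (dI a) (v a) : freeModule dJ P.
exists (fun a c => w a c).
have hA : homogeneous_mx dI dJ (fun a c => w a c).
  move=> a c m; rewrite /w ffunE; case: ifP => [le|]; last by rewrite msupp0.
  rewrite /= /poly_proj => /msuppZ_le; rewrite msuppX inE => /eqP ->.
  by rewrite submK.
exists hA => a.
have -> : mxrow_elt dJ (fun a c => w a c) a = w a by apply/ffunP=> c; rewrite ffunE.
by rewrite /w ghomP hv hu.
Qed.

Lemma mxhom_square (J J' K : finType) (dJ : J -> 'X_{1..n}) (dJ' : J' -> 'X_{1..n})
    (dK : K -> 'X_{1..n}) A B A' B' (hA : homogeneous_mx dI dJ A)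
    (hB : homogeneous_mx dJ dK B) (hA' : homogeneous_mx dI dJ' A')
    (hB' : homogeneous_mx dJ' dK B') :
  (forall a c, \sum_b A a b * B b c = \sum_b A' a b * B' b c) ->
  forall M u, mxhom hB M (mxhom hA M u) = mxhom hB' M (mxhom hA' M u).
Proof.
by move=> e M u; apply/ffunP=> c; rewrite !mxhom_comp; apply: eq_bigr => a _; rewrite e.
Qed.

Lemma mxhom_mxrow (J K : finType) (dJ : J -> 'X_{1..n})
    (dK : K -> 'X_{1..n}) (A : I -> J -> S) B (hB : homogeneous_mx dJ dK B) a c :
  mxhom hB P (mxrow_elt dJ A a) c = \sum_b A a b * B b c.
Proof.
by rewrite ffunE; apply: eq_bigr => b _; rewrite ffunE /GRing.scale /= mulrC.
Qed.

End Rows.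

Lemma tdiffK (C : freeComplex k n) M i j l (eij : i = j + 1) (ejl : j = l + 1) u :
  tdiff C M ejl (tdiff C M eij u) = 0.
Proof.
apply/ffunP=> c; rewrite mxhom_comp big1 => [|a _]; first by rewrite ffunE.
by rewrite diffK ?scale0r.
Qed.

Fact cmap_id_homog (C : freeComplex k n) j :
  homogeneous_mx (bdeg C j) (bdeg C j) (fun a c => (a == c)%:R : S).
Proof.
move=> a c m; case: eqP => [->|_]; last by rewrite msupp0.
by rewrite msupp1 inE => /eqP ->; rewrite add0m.
Qed.
Fact cmap_id_diff (C : freeComplex k n) i j : i = j + 1 ->
  forall (a : basis C i) (c : basis C j),
    \sum_b diff C i j a b * ((b == c)%:R : S) = \sum_b ((a == b)%:R : S) * diff C i j b c.
Proof.
move=> _ a c; rewrite (bigD1 c) //= eqxx mulr1 big1 ?addr0; last first.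
  by move=> b /negbTE ->; rewrite mulr0.
rewrite (bigD1 a) //= eqxx mul1r big1 ?addr0 // => b.
by rewrite eq_sym => /negbTE ->; rewrite mul0r.
Qed.
Definition chainMap_id C : chainMap C C :=
  ChainMap (@cmap_id_homog C) (@cmap_id_diff C).

Lemma tmap_id (C : freeComplex k n) M j u : tmap (chainMap_id C) M j u = u.
Proof.
apply/ffunP=> c; rewrite ffunE (bigD1 c) //= eqxx scale1r big1 ?addr0 //.
by move=> b /negbTE ->; rewrite scale0r.
Qed.

Lemma sum_mulA (J K : finType) (x : J -> S) (y : J -> K -> S) (z : K -> S) :
  \sum_b x b * (\sum_c y b c * z c) = \sum_c (\sum_b x b * y b c) * z c.
Proof.
transitivity (\sum_b \sum_c x b * y b c * z c).
  by apply: eq_bigr => b _; rewrite mulr_sumr; apply: eq_bigr => c _; rewrite mulrA.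
by rewrite exchange_big; apply: eq_bigr => c _; rewrite mulr_suml.
Qed.

Section Comp.
Variables (C D E : freeComplex k n) (f : chainMap C D) (g : chainMap D E).
Definition cmap_comp j a c := \sum_b cmap f j a b * cmap g j b c.
Fact cmap_comp_homog j : homogeneous_mx (bdeg C j) (bdeg E j) (@cmap_comp j).
Proof.
move=> a c m /msupp_sum_le /flattenP [s /mapP [b _ ->]].
move=> /msuppM_le /allpairsP [[m1 m2] /= [h1 h2 ->]].
by rewrite -addmA (cmap_homog h2) (cmap_homog h1).
Qed.
Fact cmap_comp_diff i j : i = j + 1 ->
  forall (a : basis C i) (c : basis E j),
  \sum_b diff C i j a b * cmap_comp b c = \sum_b cmap_comp a b * diff E i j b c.
Proof.
move=> e a c; rewrite /cmap_comp.
rewrite [LHS]sum_mulA.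
under eq_bigr do rewrite (cmap_diff f e).
rewrite -[LHS]sum_mulA.
under eq_bigr do rewrite (cmap_diff g e).
by rewrite sum_mulA.
Qed.
Definition chainMap_comp : chainMap C E :=
  ChainMap cmap_comp_homog cmap_comp_diff.

Lemma tmap_comp M j u : tmap chainMap_comp M j u = tmap g M j (tmap f M j u).
Proof. by apply/ffunP=> c; rewrite mxhom_comp ffunE. Qed.
End Comp.

Lemma PoszS (m : nat) : m.+1%:Z = m%:Z + 1.
Proof. by rewrite intS addrC. Qed.

Lemma basis_neg (N : gradedModule k n) (F : freeResolution N) j :
  j < 0 -> basis F j -> False.
Proof. by move=> /(res_neg F) /card0_eq h a; have := h a. Qed.

Section Lift.
Variables (N : gradedModule k n) (F G : freeResolution N).

(** Having image in the boundaries is the condition under which the next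
    component of a chain map can be constructed, and it does not mention the
    previous components; the augmentation supplies it in degree 0, so that all
    later steps are alike. *)
Definition preserves_boundaries (j : int) (A : basis F j -> basis G j -> S)
    (hA : homogeneous_mx (bdeg F j) (bdeg G j) A) :=
  forall i (e : i = j + 1) u, exists v,
    tdiff G P e v = mxhom hA P (tdiff F P e u).

Definition lift_stage (j : int) := {A : basis F j -> basis G j -> S |
  exists hA : homogeneous_mx (bdeg F j) (bdeg G j) A, preserves_boundaries hA}.

Lemma lift_stage0 : exists A : lift_stage 0,
  exists hA : homogeneous_mx (bdeg F 0) (bdeg G 0) (sval A),
  forall u, augmentation G (mxhom hA P u) = augmentation F u.
Proof.
have [A [hA e]] := @lift_homogeneous _ (bdeg F 0) _ _ _ (augmentation G)
  (fun a => augmentation F (basis_elt (bdeg F 0) a))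
  (fun a => etrans (esym (ghomP _ _ _)) (congr1 _ (basis_elt_homog _ a)))
  (fun a => res_surj G _).
have comm u : augmentation G (mxhom hA P u) = augmentation F u.
  have -> : u = \sum_a (u a : S) *: basis_elt (bdeg F 0) a.
    apply/ffunP=> c; rewrite sum_ffunE (bigD1 c) //= big1 => [|a ne].
      by rewrite !ffunE eqxx addr0 /GRing.scale /= mulr1.
    by rewrite !ffunE eq_sym (negbTE ne) scaler0.
  rewrite !linear_sum; apply: eq_bigr => a _; rewrite !linearZ /=; congr (_ *: _).
  by rewrite -e -(mxhom_basis hA).
have hB : preserves_boundaries hA.
  move=> i e1; have ei : i = 1 by rewrite e1 add0r.
  move: e1; rewrite ei => e1 u; apply/(res_exact0 G e1); rewrite comm.
  by apply/(res_exact0 F e1); exists u.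
by exists (exist _ A (ex_intro _ hA hB)), hA.
Qed.

(** A lift of A d to G_i exists because A preserves boundaries.  The new map
    preserves boundaries because d A' d = A d d = 0 and G is exact at G_i. *)
Lemma lift_stageS i j (e : i = j + 1) (A : lift_stage j) : 0 <= j ->
  exists A' : lift_stage i, forall a c,
    \sum_b diff F i j a b * sval A b c = \sum_b sval A' a b * diff G i j b c.
Proof.
case: A => A [hA hB] j0.
have [A' [hA' e']] := @lift_homogeneous _ (bdeg F i) _ _ _ (tdiff G P e)
  (fun a => mxhom hA P (tdiff F P e (basis_elt (bdeg F i) a)))
  (fun a => etrans (esym (ghomP _ _ _)) (congr1 _ (etrans (esym (ghomP _ _ _))
     (congr1 _ (basis_elt_homog _ a)))))
  (fun a => hB _ e _).
have comm a c :
    \sum_b diff F i j a b * A b c = \sum_b A' a b * diff G i j b c.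
  move/(_ a)/ffunP/(_ c): e'; rewrite mxhom_mxrow => ->.
  by rewrite (mxhom_basis (diff_homog (f := F) e)) mxhom_mxrow.
have hB' : preserves_boundaries hA'.
  move=> h eh u; apply/(res_exact G eh e); first by rewrite e; lia.
  rewrite -(@mxhom_square _ _ _ _ _ _ _ _ _ _ _ _ (diff_homog (f := F) e) hA hA'
    (diff_homog (f := G) e)) //.
  by rewrite -[mxhom (diff_homog _) _ _]/(tdiff F P e _) tdiffK raddf0.
by exists (exist _ A' (ex_intro _ hA' hB')).
Qed.

(** In negative degrees both complexes are zero, so the recursion over nat
    covers all integer degrees. *)
Lemma lift_exists : exists f : chainMap F G,
  forall u, augmentation G (tmap f P 0 u) = augmentation F u.
Proof.
have [A0 [hA0 eA0]] := lift_stage0.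
have step m : {A' : lift_stage m%:Z -> lift_stage m.+1%:Z | forall A a c,
    \sum_b diff F m.+1%:Z m%:Z a b * sval A b c
      = \sum_b sval (A' A) a b * diff G m.+1%:Z m%:Z b c}.
  apply: cid; have /choice [A' hA'] :=
    fun A : lift_stage m%:Z => @lift_stageS _ _ (PoszS m) A isT.
  by exists A'.
pose fA := fix fA m : lift_stage m%:Z :=
  match m with 0%N => A0 | m'.+1 => sval (step m') (fA m') end.
pose fc (j : int) : basis F j -> basis G j -> S :=
  match j with Posz m => sval (fA m) | Negz _ => fun _ _ => 0 end.
have fh j : homogeneous_mx (bdeg F j) (bdeg G j) (@fc j).
  case: j => [m|m]; first by case: (svalP (fA m)).
  by move=> a c p; rewrite msupp0.
have fd i j : i = j + 1 -> forall (a : basis F i) (c : basis G j),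
    \sum_b diff F i j a b * fc j b c = \sum_b fc i a b * diff G i j b c.
  case: j => [m|m] e.
    have ei : i = m.+1%:Z by rewrite e PoszS.
    by clear e; subst i => a c; rewrite /= (svalP (step m)).
  by move=> a c; case: (basis_neg _ c).
exists (ChainMap fh fd) => u; rewrite -eA0; congr (augmentation _ _).
Qed.

End Lift.

Section Homotopy.
Variables (N : gradedModule k n) (F G : freeResolution N) (f g : chainMap F G).
Hypothesis fg_aug : forall u,
  augmentation G (tmap f P 0 u) = augmentation G (tmap g P 0 u).

(** Candidates for the component F_j -> G_i of a homotopy from f to g.  If
    f - g = d s + s' d, composing with d on the right removes s'; the
    resulting condition on s alone is what the construction of the next
    component uses. *)
Definition homotopy_stage (i j : int) := {s : basis F j -> basis G i -> S |
  exists hs : homogeneous_mx (bdeg F j) (bdeg G i) s,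
  forall h (eij : i = j + 1) (e : h = j + 1) u,
    tdiff G P eij (mxhom hs P (tdiff F P e u))
      = tmap f P j (tdiff F P e u) - tmap g P j (tdiff F P e u)}.

(** The homotopy relation is an identity of matrices over S, so it holds after
    tensoring with any M. *)
Lemma homotopyP h i j (ehi : h = i + 1) (eij : i = j + 1)
    (s' : basis F i -> basis G h -> S) (s : basis F j -> basis G i -> S)
    (hs' : homogeneous_mx (bdeg F i) (bdeg G h) s')
    (hs : homogeneous_mx (bdeg F j) (bdeg G i) s) :
  (forall a c, cmap f i a c - cmap g i a c =
    \sum_b s' a b * diff G h i b c + \sum_b diff F i j a b * s b c) ->
  forall M u, tmap f M i u - tmap g M i u =
    tdiff G M ehi (mxhom hs' M u) + mxhom hs M (tdiff F M eij u).
Proof.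
move=> e M u; apply/ffunP=> c.
rewrite [in LHS]ffunE [in RHS]ffunE !mxhom_comp !ffunE -sumrB -big_split /=.
by apply: eq_bigr => a _; rewrite -scalerBl -scalerDl e.
Qed.

Lemma homotopy_stage0 : exists s : homotopy_stage 1 0, forall a c,
  cmap f 0 a c - cmap g 0 a c = \sum_b sval s a b * diff G 1 0 b c.
Proof.
have e10 : 1 = 0 + 1 :> int by rewrite add0r.
pose u a := tmap f P 0 (basis_elt (bdeg F 0) a) - tmap g P 0 (basis_elt (bdeg F 0) a).
have [||s [hs es]] := @lift_homogeneous _ (bdeg F 0) _ _ _ (tdiff G P e10) u.
- by move=> a; apply: homog_sub; apply: ghom_basis_homog.
- move=> a; apply/(res_exact0 G e10).
  exact: ghom_sub0 (fg_aug _).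
have comm a c : cmap f 0 a c - cmap g 0 a c = \sum_b s a b * diff G 1 0 b c.
  move/(_ a)/ffunP/(_ c): es; rewrite mxhom_mxrow => ->.
  by rewrite /u /tmap !mxhom_basis !ffunE.
have Q : exists hs : homogeneous_mx (bdeg F 0) (bdeg G 1) s,
  forall h (eij : 1 = 0 + 1) (e : h = 0 + 1) u,
    tdiff G P eij (mxhom hs P (tdiff F P e u))
      = tmap f P 0 (tdiff F P e u) - tmap g P 0 (tdiff F P e u).
  exists hs => h eij e v; apply/ffunP=> c; rewrite mxhom_comp !ffunE -sumrB.
  by apply: eq_bigr => a _; rewrite -scalerBl comm.
by exists (exist _ s Q).
Qed.

(** The next component lifts f - g - s d, which is a cycle by the condition on
    s, hence a boundary as G is exact in positive degrees. *)
Lemma homotopy_stageS h i j (ehi : h = i + 1) (eij : i = j + 1) (s : homotopy_stage i j) :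
  0 <= j -> exists s' : homotopy_stage h i, forall a c,
  cmap f i a c - cmap g i a c =
    \sum_b sval s' a b * diff G h i b c + \sum_b diff F i j a b * sval s b c.
Proof.
case: s => s [hs es] j0 /=.
pose u a := tmap f P i (basis_elt (bdeg F i) a) - tmap g P i (basis_elt (bdeg F i) a)
  - mxhom hs P (tdiff F P eij (basis_elt (bdeg F i) a)).
have uE a c : u a c = cmap f i a c - cmap g i a c - \sum_b diff F i j a b * s b c.
  by rewrite -(mxhom_mxrow _ hs) /u /tmap /tdiff !mxhom_basis !ffunE.
have [||s' [hs' es']] := @lift_homogeneous _ (bdeg F i) _ _ _ (tdiff G P ehi) u.
- move=> a; apply: homog_sub.
    by apply: homog_sub; apply: ghom_basis_homog.
  have e1 := ghom_basis_homog (tdiff F P eij) a.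
  by rewrite -[in RHS]e1 ghomP.
- move=> a; apply/(res_exact G ehi eij); first by rewrite eij; lia.
  exact: ghom_subsub0 (tdiff_tmap f eij _) (tdiff_tmap g eij _) (es _ eij eij _).
have comm a c : cmap f i a c - cmap g i a c =
    \sum_b s' a b * diff G h i b c + \sum_b diff F i j a b * s b c.
  move/(_ a)/ffunP/(_ c): es'; rewrite mxhom_mxrow => ->.
  by rewrite uE subrK.
have Q : exists hs : homogeneous_mx (bdeg F i) (bdeg G h) s',
  forall h' (eij : h = i + 1) (e : h' = i + 1) u,
    tdiff G P eij (mxhom hs P (tdiff F P e u))
      = tmap f P i (tdiff F P e u) - tmap g P i (tdiff F P e u).
  exists hs' => h' e1 e v; rewrite (homotopyP e1 eij hs' hs comm).
  by rewrite tdiffK raddf0 addr0.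
by exists (exist _ s' Q).
Qed.

Lemma homotopy_exists h i j (ehi : h = i + 1) (eij : i = j + 1) :
  exists s' (hs' : homogeneous_mx (bdeg F i) (bdeg G h) s')
         s (hs : homogeneous_mx (bdeg F j) (bdeg G i) s),
  forall M u, tmap f M i u - tmap g M i u =
    tdiff G M ehi (mxhom hs' M u) + mxhom hs M (tdiff F M eij u).
Proof.
have [s0 es0] := homotopy_stage0.
have step m : {s' : homotopy_stage m.+1%:Z m%:Z -> homotopy_stage m.+2%:Z m.+1%:Z |
    forall s a c,
    cmap f m.+1%:Z a c - cmap g m.+1%:Z a c =
    \sum_b sval (s' s) a b * diff G m.+2%:Z m.+1%:Z b c
    + \sum_b diff F m.+1%:Z m%:Z a b * sval s b c}.
  apply: cid; have /choice [s' hs'] :=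
    fun s : homotopy_stage _ m%:Z => @homotopy_stageS _ _ _ (PoszS _) (PoszS m) s isT.
  by exists s'.
pose fs := fix fs m : homotopy_stage m.+1%:Z m%:Z :=
  match m with 0%N => s0 | m'.+1 => sval (step m') (fs m') end.
have h0 (I J : finType) (dI : I -> 'X_{1..n}) (dJ : J -> 'X_{1..n}) :
    homogeneous_mx dI dJ (fun _ _ => 0 : S) by move=> a c m; rewrite msupp0.
case: i ehi eij => [[|m]|m] ehi eij.
- have eh : h = 1 by rewrite ehi add0r.
  move: ehi; rewrite eh => ehi; case: (svalP s0) => hs0 _.
  exists (sval s0), hs0, _, (h0 _ _ _ _); apply: homotopyP => a c.
  rewrite es0 -[LHS]addr0; congr (_ + _); apply/esym/big1 => b _; exact: mulr0.
- have eh : h = m.+2%:Z by rewrite ehi -PoszS.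
  have ej : j = m%:Z by move: eij; rewrite PoszS => /addIr ->.
  move: ehi eij; rewrite eh ej => ehi eij; case: (svalP (fs m)) => hs _;
    case: (svalP (fs m.+1)) => hs' _.
  exists (sval (fs m.+1)), hs', (sval (fs m)), hs; apply: homotopyP => a c.
  by have := svalP (step m) (fs m) a c.
exists _, (h0 _ _ _ _), _, (h0 _ _ _ _); apply: homotopyP => a c.
by case: (basis_neg _ a).
Qed.
End Homotopy.

(** The composites g f and f g lift the identity of N, as the identity maps of F
    and G do, so they are homotopic to these; on a cycle the term s d of the
    homotopy vanishes. *)
Lemma comparison N (F G : freeResolution N) :
  exists (f : chainMap F G) (g : chainMap G F),
  forall h i j (ehi : h = i + 1) (eij : i = j + 1) M,
    (forall u, tdiff F M eij u = 0 ->
       homologous (tdiff F M ehi) (tmap g M i (tmap f M i u)) u) /\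
    (forall u, tdiff G M eij u = 0 ->
       homologous (tdiff G M ehi) (tmap f M i (tmap g M i u)) u).
Proof.
have [f ef] := lift_exists F G; have [g eg] := lift_exists G F.
exists f, g => h i j ehi eij M; split=> u u0.
  have [|s' [hs' [s [hs e]]]] :=
      @homotopy_exists _ F F (chainMap_comp f g) (chainMap_id F) _ h i j ehi eij.
    by move=> v; rewrite tmap_comp tmap_id eg ef.
  exists (mxhom hs' M u).
  by have := e M u; rewrite tmap_comp tmap_id u0 raddf0 addr0 => ->.
have [|s' [hs' [s [hs e]]]] :=
    @homotopy_exists _ G G (chainMap_comp g f) (chainMap_id G) _ h i j ehi eij.
  by move=> v; rewrite tmap_comp tmap_id ef eg.
exists (mxhom hs' M u).
by have := e M u; rewrite tmap_comp tmap_id u0 raddf0 addr0 => ->.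
Qed.

End Comparison.

(** * Representatives of homology classes *)
Section HomologyRep.
Variables (k : fieldType) (n : nat).
Local Notation S := {mpoly k[n]}.

Section One.
Variables (L M N : gradedModule k n) (f : gradedHom L M) (g : gradedHom M N).

Definition hrep (x : homology f g) : M :=
  submod_val (repr (x : quot_of (boundaries f g))).

Lemma hclass_eq (z z' : gsub (gker g)) :
  hclass f z = hclass f z' <-> homologous f (submod_val z) (submod_val z').
Proof.
rewrite /hclass; split => [/quot_eqP|[y ey]].
  by rewrite unfold_in => /asboolP.
by apply/quot_eqP; rewrite unfold_in; apply/asboolP; exists y.
Qed.

Lemma hclassK (x : homology f g) : hclass f (repr (x : quot_of (boundaries f g))) = x.
Proof. exact: reprK. Qed.

Lemma hrep_cycle x : g (hrep x) = 0.
Proof. exact/eqP/(submod_valP (repr (x : quot_of (boundaries f g)))). Qed.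

Lemma hrep_class z : homologous f (hrep (hclass f z)) (submod_val z).
Proof. by apply/hclass_eq; rewrite hclassK. Qed.

Lemma hrep_inj x x' : homologous f (hrep x) (hrep x') -> x = x'.
Proof. by move/hclass_eq; rewrite !hclassK. Qed.

Lemma hrep_linear (p : S) x y :
  homologous f (hrep (p *: x + y)) (p *: hrep x + hrep y).
Proof.
have -> : p *: x + y = hclass f (p *: repr (x : quot_of (boundaries f g))
                                 + repr (y : quot_of (boundaries f g))).
  by rewrite /hclass linearP; congr (_ *: _ + _); apply/esym/hclassK.
have [v ev] := hrep_class (p *: repr (x : quot_of (boundaries f g))
    + repr (y : quot_of (boundaries f g))).
by exists v; rewrite ev.
Qed.

Lemma hrep_proj b x : homologous f (hrep (gproj b x)) (gproj b (hrep x)).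
Proof.
set z := repr (x : quot_of (boundaries f g)).
have -> : gproj b x = hclass f (gproj b z).
  by rewrite -[x in LHS]hclassK /= pi_proj.
exact: hrep_class.
Qed.

Lemma hrep_homog b (w : component (homology f g) b) :
  homologous f (hrep (cval w)) (gproj b (hrep (cval w))).
Proof. by have := hrep_proj b (cval w); rewrite (eqP (cvalP w)). Qed.

Lemma component_eq b (w w' : component (homology f g) b) :
  homologous f (hrep (cval w)) (hrep (cval w')) -> w = w'.
Proof. by move=> h; apply/val_inj/hrep_inj. Qed.

Lemma hrep0 : homologous f (hrep (0 : homology f g)) 0.
Proof.
have e : hclass f (0 : gsub (gker g)) = 0 :> homology f g by exact: raddf0.
by rewrite -e; apply: hrep_class.
Qed.

Lemma component_rep b (z : M) : g z = 0 -> gproj b z = z ->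
  exists w : component (homology f g) b, homologous f (hrep (cval w)) z.
Proof.
move=> gz bz.
have zP : z \in submod_pred (gker g) by apply/eqP.
have wP : hclass f (SubmodOf zP : gsub (gker g)) \in @homogeneous k n (homology f g) b.
  apply/eqP; rewrite /= pi_proj; congr (\pi _).
  by apply: val_inj.
by exists (Component wP); apply: hrep_class.
Qed.
End One.

Section Map.
Variables (L M N L' M' N' : gradedModule k n).
Variables (f : gradedHom L M) (g : gradedHom M N).
Variables (f' : gradedHom L' M') (g' : gradedHom M' N').
Variable h : gradedHom M M'.
Hypothesis h_ker : forall x, g x = 0 -> g' (h x) = 0.
Hypothesis h_im : forall x, exists y, h (f x) = f' y.

Lemma hrep_map x :
  homologous f' (hrep (homology_map h_ker h_im x)) (h (hrep x)).
Proof. exact: hrep_class. Qed.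
End Map.
End HomologyRep.

(** * The complex of Delta in a fixed degree *)
Section Coordinates.
Variables (k : fieldType) (n : nat).
Local Notation S := {mpoly k[n]}.
Local Notation P := (polyModule k n).

Lemma mcoeffXM (v : 'I_n) (p : S) m :
  ('X_v * p)@_m = if (0 < m v)%N then p@_(m - U_(v)) else 0.
Proof.
case: ifP => h.
  have {1}-> : m = (m - U_(v) + U_(v))%MM.
    by rewrite submK //; apply/mnm_lepP => l; rewrite mnm1E; case: eqP => // <-.
  by rewrite mulrC addmC mcoeffMX.
apply/eqP; rewrite mulrC mcoeff_eq0 (perm_mem (msuppMX _ _)).
by apply/mapP => -[c _ ec]; move: h; rewrite ec mnmDE mnm1E eqxx.
Qed.

Lemma setmnm_le (J : {set 'I_n}) (b : 'X_{1..n}) :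
  reflect (forall l, l \in J -> (0 < b l)%N) (setmnm J <= b)%MM.
Proof.
apply: (iffP mnm_lepP) => h l; first by move=> lJ; have := h l; rewrite mnmE lJ.
by rewrite mnmE; case: (boolP (l \in J)) => //; apply: h.
Qed.

Lemma mcoeff_signM e (p : S) m : ((-1) ^+ e * p)@_m = (-1) ^+ e * p@_m.
Proof. by rewrite -mcoeffCM rmorphXn /= mpolyCN mpolyC1. Qed.

Definition ksign (J : {set 'I_n}) (v : 'I_n) : nat := #|[set l in J | (l < v)%N]|.

Variable b : 'X_{1..n}.

(** The incidence number of J' and J in the chain complex of the full simplex on
    the support of b: the matrix of the Koszul differential in degree b, in the
    bases x^(b - e_J) v_J. *)
Definition incidence (J' J : {set 'I_n}) : k :=
  if (setmnm J' <= b)%MM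
  then \sum_(v in J' | J' :\ v == J) (-1) ^+ ksign J' v else 0.

Lemma setmnmD1 (J : {set 'I_n}) v : v \in J ->
  setmnm J = (setmnm (J :\ v) + U_(v))%MM.
Proof.
move=> vJ; apply/mnmP => l; rewrite mnmDE mnm1E !mnmE !inE [v == l]eq_sym.
by case: eqP => [->|_] /=; rewrite ?vJ ?addn0.
Qed.

Lemma incidence_eq0 (J' J : {set 'I_n}) :
  ~~ (setmnm J <= b)%MM -> incidence J' J = 0.
Proof.
move=> Jb; rewrite /incidence; case: ifP => // J'b; rewrite big_pred0 // => v.
apply: contraNF Jb => /andP [_ /eqP <-]; apply: lepm_trans J'b.
by apply/setmnm_le => l; rewrite !inE mnmE => /andP [_ ->].
Qed.

Lemma incidence_coef (J' J : {set 'I_n}) (p : S) : (setmnm J <= b)%MM ->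
  (koszul_coef k J' J * p)@_(b - setmnm J)
    = incidence J' J * (if (setmnm J' <= b)%MM then p@_(b - setmnm J') else 0).
Proof.
move=> Jb; rewrite /incidence /koszul_coef mulr_suml raddf_sum /=.
case: ifP => J'b; last first.
  rewrite mul0r big1 // => v /andP [vJ' /eqP eJ].
  rewrite -mulrA mcoeff_signM mcoeffXM; case: ifP => h; last by rewrite mulr0.
  case/negP: J'b; apply/setmnm_le => l lJ'; case: (eqVneq l v) => [->|ne].
    by move: h; rewrite mnmBE; lia.
  by move/setmnm_le: Jb; apply; rewrite -eJ !inE ne.
rewrite mulr_suml; apply: eq_bigr => v /andP [vJ' /eqP eJ].
rewrite -mulrA mcoeff_signM mcoeffXM.
have e : (b - setmnm J)%MM = (b - setmnm J' + U_(v))%MM.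
  apply/mnmP => l; rewrite mnmDE !mnmBE (setmnmD1 vJ') eJ mnmDE.
  by move/mnm_lepP/(_ l): J'b; rewrite (setmnmD1 vJ') eJ mnmDE; lia.
by rewrite e mnmDE mnm1E eqxx addn1 /= addmK.
Qed.

Lemma mcoeff_poly_proj c (p : S) : (poly_proj c p : S)@_c = p@_c.
Proof. by rewrite /poly_proj mcoeffZ mcoeffX eqxx mulr1. Qed.

Lemma mcoeffZXm a m : (a *: 'X_[m] : S)@_m = a.
Proof. by rewrite mcoeffZ mcoeffX eqxx mulr1. Qed.

Lemma poly_projZX a m : poly_proj m (a *: 'X_[m] : S) = a *: 'X_[m].
Proof. by rewrite /poly_proj mcoeffZXm. Qed.

Section Chains.
Variable Delta : simplicialComplex n.
Local Notation K := (koszulComplex k Delta).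

Definition chain_coef j (J : face Delta j) (z : tensor K P j) : k :=
  if (face_deg J <= b)%MM then (z J : S)@_(b - face_deg J) else 0.

Lemma chain_coef_sub j (J : face Delta j) z z' :
  chain_coef J (z - z') = chain_coef J z - chain_coef J z'.
Proof. by rewrite /chain_coef !ffunE; case: ifP; rewrite ?mcoeffB ?subr0. Qed.

Lemma chain_coef_lin j (J : face Delta j) (a : k) z z' :
  chain_coef J (a%:MP *: z + z') = a * chain_coef J z + chain_coef J z'.
Proof.
rewrite /chain_coef !ffunE; case: ifP; rewrite ?mulr0 ?addr0 //.
by rewrite /GRing.scale /= mcoeffD mcoeffCM.
Qed.

Lemma chain_coef_gproj j (J : face Delta j) z : chain_coef J (gproj b z) = chain_coef J z.
Proof.
rewrite /chain_coef; case: ifP => // h; rewrite ffunE h; exact: mcoeff_poly_proj.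
Qed.

Lemma chain_coef_eq0 j z : (forall J : face Delta j, chain_coef J z = 0) -> gproj b z = 0.
Proof.
move=> h; apply/ffunP => J; have := h J; rewrite !ffunE /chain_coef.
by case: ifP => // _ /=; rewrite /poly_proj => ->; rewrite scale0r.
Qed.

Lemma chain_coef_tdiff i j (e : i = j + 1) z (J : face Delta j) :
  chain_coef J (tdiff K P e z)
    = \sum_(J' : face Delta i) incidence (val J') (val J) * chain_coef J' z.
Proof.
rewrite {1}/chain_coef; case: ifP => h; last first.
  by rewrite big1 // => J' _; rewrite incidence_eq0 ?mul0r // -[setmnm _]/(face_deg J) h.
rewrite ffunE raddf_sum; apply: eq_bigr => J' _.
exact: incidence_coef.
Qed.

Definition chain j (a : face Delta j -> k) : tensor K P j :=
  [ffun J => if (face_deg J <= b)%MM then a J *: 'X_[b - face_deg J] : S else 0].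

Lemma chain_coef_chain j (a : face Delta j -> k) J :
  chain_coef J (chain a) = if (face_deg J <= b)%MM then a J else 0.
Proof.
rewrite /chain_coef ffunE; case: ifP => // h; rewrite ?h; exact: mcoeffZXm.
Qed.

Lemma chain_homog j (a : face Delta j -> k) : gproj b (chain a) = chain a.
Proof.
apply/ffunP => J; rewrite !ffunE; case: ifP => // h; rewrite h.
exact: poly_projZX.
Qed.
End Chains.
End Coordinates.

(** * The Koszul complex of the Stanley-Reisner ring in a squarefree degree *)
Section Cochains.
Variables (k : fieldType) (n : nat).
Local Notation S := {mpoly k[n]}.
Local Notation P := (polyModule k n).

Fact full_sub (J K : {set 'I_n}) : K \subset J -> J \in setT -> K \in [set: {set 'I_n}].
Proof. by move=> _ _; rewrite inE. Qed.

Definition fullSimplex : simplicialComplex n :=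
  SimplicialComplex full_sub (in_setT set0) (fun i => in_setT [set i]).

Lemma sum_face (V : nmodType) (Delta : simplicialComplex n) j (G : {set 'I_n} -> V) :
  \sum_(J : face Delta j) G (val J)
    = \sum_(J | (J \in faces Delta) && (#|J|%:Z == j)) G J.
Proof.
rewrite [RHS](reindex_omap (val : face Delta j -> _) insub) /=; last first.
  by move=> K hK; rewrite insubT.
by apply: eq_bigl => J; rewrite valK (valP J) eqxx.
Qed.

Lemma setmnm_inj : injective (@setmnm n).
Proof.
move=> J K /mnmP e; apply/setP => l; have := e l; rewrite !mnmE.
by case: (l \in J); case: (l \in K).
Qed.

Section SR.
Variable Delta : simplicialComplex n.
Local Notation A := (stanleyReisner k Delta).
Local Notation piA := (\pi_(quot_of (SRideal k Delta)) : S -> A).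

Lemma SRideal_mcoeff (p : P) J : J \in faces Delta ->
  p \in submod_pred (SRideal k Delta) -> (p : S)@_(setmnm J) = 0.
Proof.
move=> JD; rewrite unfold_in => /asboolP [c ->].
rewrite raddf_sum big1 // => K _; apply/eqP; rewrite mcoeff_eq0 (perm_mem (msuppMX _ _)).
apply/mapP => -[m _ em]; case/negP: (valP K); apply: faces_sub JD.
apply/subsetP => l lK; have := congr1 (fun m : 'X_{1..n} => m l) em.
by rewrite mnmDE !mnmE lK; case: (l \in J).
Qed.

Definition sr_coef (J : {set 'I_n}) (x : A) : k :=
  (repr (x : quot_of (SRideal k Delta)) : S)@_(setmnm J).

(** Taking the coefficient on a representative is legitimate only for faces: the
    monomial of a nonface lies in the ideal. *)
Lemma sr_coef_pi J (p : S) : J \in faces Delta -> sr_coef J (piA p) = p@_(setmnm J).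
Proof.
move=> JD; apply/eqP; rewrite -subr_eq0 /sr_coef -mcoeffB; apply/eqP.
by apply: SRideal_mcoeff JD _; apply/quot_eqP; rewrite reprK.
Qed.

Lemma sr_piP (x : A) : exists p : S, x = piA p.
Proof. by elim/quot_ind: x => p; exists p. Qed.

Lemma sr_coef_scale J (q p : S) : J \in faces Delta ->
  sr_coef J (q *: piA p) = (q * p)@_(setmnm J).
Proof.
by move=> JD; have e := sr_coef_pi (q * p) JD; rewrite -[RHS]e -linearZ.
Qed.

Lemma sr_coefD J x y : J \in faces Delta -> sr_coef J (x + y) = sr_coef J x + sr_coef J y.
Proof.
move=> JD; case: (sr_piP x) => p ->; case: (sr_piP y) => q ->.
by rewrite !sr_coef_pi // -mcoeffD -(sr_coef_pi _ JD) raddfD.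
Qed.

Lemma sr_coef0 J : J \in faces Delta -> sr_coef J 0 = 0.
Proof.
by move=> JD; have e := sr_coef_pi 0 JD; rewrite mcoeff0 raddf0 in e.
Qed.

Lemma sr_coef_sum J (I : Type) (r : seq I) (Q : pred I) F : J \in faces Delta ->
  sr_coef J (\sum_(i <- r | Q i) F i) = \sum_(i <- r | Q i) sr_coef J (F i).
Proof.
move=> JD; apply: (big_morph _ _ (sr_coef0 JD)) => x y; exact: sr_coefD.
Qed.

Lemma sr_coefC J (a : k) x : J \in faces Delta ->
  sr_coef J (a%:MP *: x) = a * sr_coef J x.
Proof.
by move=> JD; case: (sr_piP x) => p ->; rewrite sr_coef_scale // mcoeffCM sr_coef_pi.
Qed.

Lemma sr_coefX J e v x : J \in faces Delta ->
  sr_coef J (((-1) ^+ e * 'X_v : S) *: x)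
    = if v \in J then (-1) ^+ e * sr_coef (J :\ v) x else 0.
Proof.
move=> JD; case: (sr_piP x) => p ->.
rewrite sr_coef_scale // -mulrA mcoeff_signM mcoeffXM mnmE.
case: (boolP (v \in J)) => vJ /=; last by rewrite mulr0.
have JvD : J :\ v \in faces Delta by apply: faces_sub JD; apply: subD1set.
by rewrite (sr_coef_pi _ JvD) (setmnmD1 vJ) addmK.
Qed.

(** Together with the next lemma: in degree e_J the ring k[Delta] is spanned by
    the monomial x_J, and this is zero if J is not a face. *)
Lemma sr_gproj_face J (x : A) : J \in faces Delta -> sr_coef J x = 0 ->
  gproj (setmnm J) x = 0.
Proof.
move=> JD; case: (sr_piP x) => p ->; rewrite sr_coef_pi // => e.
by rewrite /= pi_proj /= /poly_proj e scale0r raddf0.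
Qed.

Lemma sr_gproj_nonface J (x : A) : J \notin faces Delta -> gproj (setmnm J) x = 0.
Proof.
move=> JD; case: (sr_piP x) => p ->; rewrite /= pi_proj /= /poly_proj.
rewrite -[RHS](raddf0 (\pi_(quot_of (SRideal k Delta)))); apply/quot_eqP.
rewrite subr0 unfold_in; apply/asboolP.
exists (fun K : nonface Delta => (K == exist _ J JD)%:R * (p@_(setmnm J))%:MP).
rewrite (bigD1 (exist _ J JD : nonface Delta)) //= eqxx mul1r mul_mpolyC.
by rewrite big1 ?addr0 // => K /negbTE ->; rewrite !mul0r.
Qed.

Variable b : 'X_{1..n}.
Hypothesis b_sqfree : forall l : 'I_n, (b l <= 1)%N.
Local Notation Kf := (koszulComplex k fullSimplex).
Local Notation B := [set l : 'I_n | (0 < b l)%N].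

(** The coefficient of v_L (x) x_J, where L is the complement of J in the support
    of b.  The sum has at most one term; writing it as a sum avoids a proof that
    this complement has q elements. *)
Definition cochain_coef q (J : {set 'I_n}) (t : tensor Kf A q) : k :=
  \sum_(L : face fullSimplex q | (setmnm J + face_deg L)%MM == b) sr_coef J (t L).

Lemma cochain_coef_face q J (L : face fullSimplex q) (t : tensor Kf A q) :
  (setmnm J + face_deg L)%MM = b -> cochain_coef J t = sr_coef J (t L).
Proof.
move=> e; rewrite /cochain_coef (big_pred1 L) // => L'.
apply/eqP/eqP => [e'|->//]; apply/val_inj/setmnm_inj.
by apply: (@addmI _ (setmnm J)); apply: etrans e' (esym e).
Qed.

Lemma cochain_coef_gt q J (t : tensor Kf A q) :
  ~~ (setmnm J <= b)%MM -> cochain_coef J t = 0.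
Proof.
by move=> h; rewrite /cochain_coef big_pred0 // => L; apply: contraNF h => /eqP <-;
  rewrite lem_addr.
Qed.

Lemma cochain_coef_sub q J (t t' : tensor Kf A q) : J \in faces Delta ->
  cochain_coef J (t - t') = cochain_coef J t - cochain_coef J t'.
Proof.
move=> JD; rewrite /cochain_coef -sumrB; apply: eq_bigr => L _.
apply/eqP; rewrite -[X in _ == X]addr0 -subr_eq subr0 eq_sym subr_eq.
by rewrite -sr_coefD // !ffunE subrK.
Qed.

Lemma cochain_coef_zero q J : J \in faces Delta -> cochain_coef J (0 : tensor Kf A q) = 0.
Proof. by move=> JD; rewrite -(subrr (0 : tensor Kf A q)) cochain_coef_sub // subrr. Qed.

Lemma cochain_coef_lin q J (a : k) (t t' : tensor Kf A q) : J \in faces Delta ->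
  cochain_coef J (a%:MP *: t + t') = a * cochain_coef J t + cochain_coef J t'.
Proof.
move=> JD; rewrite /cochain_coef mulr_sumr -big_split; apply: eq_bigr => L _ /=.
by rewrite !ffunE sr_coefD // sr_coefC.
Qed.

Lemma setmnm_suppD J : (setmnm J <= b)%MM -> (setmnm J + setmnm (B :\: J))%MM = b.
Proof.
move=> /mnm_lepP h; apply/mnmP => l; have := h l; have := b_sqfree l.
by rewrite mnmDE !mnmE !inE; case: (l \in J); case: (b l) => [|[|m]].
Qed.

Lemma mdeg_setmnm (J : {set 'I_n}) : mdeg (setmnm J) = #|J|.
Proof.
rewrite mdegE -sum1_card [RHS]big_mkcond; apply: eq_bigr => l _.
by rewrite mnmE; case: (l \in J).
Qed.

Lemma compl_face i q (J : face Delta i) : i + q = (mdeg b)%:Z ->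
  (face_deg J <= b)%MM ->
  (B :\: val J \in faces fullSimplex) && (#|B :\: val J|%:Z == q).
Proof.
move=> e Jb; rewrite inE /=; have /andP [_ /eqP Jc] := valP J.
have := congr1 mdeg (setmnm_suppD Jb); rewrite mdegD !mdeg_setmnm => e'.
by apply/eqP/(addrI i); rewrite e -e' PoszD Jc.
Qed.

(** The vertex v moves from L to J with the Koszul sign of v in L, while it moves
    from J to L with that of v in J.  The product of these signs is
    (-1)^(number of l < v in B), and multiplying it over v in J turns the first
    differential into the transpose of the second. *)
Definition dual_sign (J : {set 'I_n}) : k := \prod_(v in J) (-1) ^+ ksign B v.

Lemma dual_sign_neq0 J : dual_sign J != 0.
Proof. by apply/prodf_neq0 => v _; rewrite signr_eq0. Qed.

Lemma dual_sign_ksign (J : {set 'I_n}) v : (setmnm J <= b)%MM -> v \in J ->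
  dual_sign J * (-1) ^+ ksign (v |: (B :\: J)) v = (-1) ^+ ksign J v * dual_sign (J :\ v).
Proof.
move=> /setmnm_le Jb vJ; rewrite /dual_sign (big_setD1 v) //= mulrC mulrA; congr (_ * _).
have -> : ksign B v = (ksign J v + ksign (v |: (B :\: J)) v)%N.
  rewrite /ksign -cardsUI; set I := (X in (_ + #|pred_of_set X|)%N).
  have -> : I = set0.
    apply/setP=> l; rewrite !inE; case: (boolP (l \in J)) => lJ //=.
    by case: (eqVneq l v) => [->|_] /=; rewrite ?ltnn ?andbF.
  rewrite cards0 addn0; apply: eq_card => l; rewrite !inE.
  case: (boolP (l \in J)) => lJ /=;
    first by rewrite (Jb _ lJ) /=; case: (l < v)%N; rewrite ?andbF.
  by case: (eqVneq l v) => [->|_] /=; rewrite ?ltnn ?andbF.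
by rewrite exprD mulrC -mulrA -expr2 sqrr_sign mulr1.
Qed.

(** The differential is the transpose of that of the complex of Delta.  Both
    sides are sums over the vertices v of J': on the left v is the vertex that
    is removed from a set L, on the right it is the one removed from J'. *)
Lemma cochain_coef_tdiff i i' p q (ei : i' = i + 1) (e : p = q + 1)
    (t : tensor Kf A p) (J' : face Delta i') : i' + q = (mdeg b)%:Z ->
  dual_sign (val J') * cochain_coef (val J') (tdiff Kf A e t)
    = \sum_(J : face Delta i)
        incidence k b (val J') (val J) * (dual_sign (val J) * cochain_coef (val J) t).
Proof.
move=> eq; have [J'b|J'b] := boolP (face_deg J' <= b)%MM; last first.
  rewrite cochain_coef_gt // mulr0 big1 // => J _.
  by rewrite /incidence -[setmnm _]/(face_deg J') (negbTE J'b) mul0r.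
have /andP [J'D /eqP J'c] := valP J'.
set L' : face fullSimplex q := exist _ (B :\: val J') (compl_face eq J'b).
have eL' : (setmnm (val J') + face_deg L')%MM = b by exact: setmnm_suppD.
rewrite (cochain_coef_face _ eL') ffunE sr_coef_sum // mulr_sumr.
have vL' v : v \in val J' -> v \notin val L' by move=> h; rewrite !inE h.
pose h (v : 'I_n) := if v \in val J' then
  (-1) ^+ ksign (val J') v
    * (dual_sign (val J' :\ v) * cochain_coef (val J' :\ v) t) else 0.
transitivity (\sum_v h v).
  transitivity (\sum_(L : face fullSimplex p)
      \sum_(v | (v \in val L) && (val L :\ v == val L')) h v).
    apply: eq_bigr => L _.
    rewrite /= /koszul_diff /koszul_coef scaler_suml sr_coef_sum // mulr_sumr.
    apply: eq_bigr => v /andP [vL /eqP eL]; rewrite sr_coefX // /h.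
    case: ifP => vJ'; last by rewrite mulr0.
    have eL2 : val L = v |: (B :\: val J').
      by rewrite -(setD1K vL) eL.
    have e2 : (setmnm (val J' :\ v) + face_deg L)%MM = b.
      rewrite -eL' /face_deg (setmnmD1 vL) (setmnmD1 vJ') eL.
      by rewrite -addmA; congr (_ + _)%MM; apply: addmC.
    rewrite (cochain_coef_face _ e2) -/(ksign _ _) eL2 mulrA.
    by rewrite (dual_sign_ksign J'b vJ') mulrA.
  rewrite (exchange_big_dep predT) //=; apply: eq_bigr => v _; rewrite /h.
  case: ifP => vJ'; last by rewrite big1.
  have LP : (v |: val L' \in faces fullSimplex) && (#|v |: val L'|%:Z == p).
    rewrite inE cardsU1 vL' //= e; have /andP [_ /eqP <-] := valP L'.
    by rewrite add1n intS addrC.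
  rewrite (big_pred1 (exist _ (v |: val L') LP : face fullSimplex p)) // => L.
  apply/andP/eqP => [[vL /eqP eL]|->].
    by apply: val_inj; rewrite /= -(setD1K vL) -eL.
  by rewrite /= setU11 setU1K ?vL'.
rewrite /incidence J'b.
under [RHS]eq_bigr do rewrite mulr_suml.
rewrite (exchange_big_dep (fun v => v \in val J')) /=; last by move=> J v _ /andP [].
rewrite [RHS]big_mkcond; apply: eq_bigr => v _; rewrite /h; case: ifP => // vJ'.
have JP : (val J' :\ v \in faces Delta) && (#|val J' :\ v|%:Z == i).
  rewrite (faces_sub _ J'D) ?subD1set //=; apply/eqP/(addIr 1);
    apply: etrans (etrans J'c ei).
  by rewrite (cardsD1 v (val J')) vJ' intS addrC.
rewrite (big_pred1 (exist _ (val J' :\ v) JP : face Delta i)) // => J.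
by rewrite -(inj_eq val_inj) /= eq_sym.
Qed.

Definition cochain i q (c : face Delta i -> k) : tensor Kf A q :=
  [ffun L => piA (\sum_(J : face Delta i | (face_deg J + face_deg L)%MM == b)
     c J *: 'X_[face_deg J])].

Lemma face_deg_inj i (J J' : face Delta i) : (face_deg J == face_deg J') = (J == J').
Proof. by apply/eqP/eqP => [/setmnm_inj/val_inj|->]. Qed.

Lemma cochain_coef_cochain i q (c : face Delta i -> k) (J : face Delta i) :
  i + q = (mdeg b)%:Z ->
  cochain_coef (val J) (cochain q c) = if (face_deg J <= b)%MM then c J else 0.
Proof.
move=> e; have [Jb|Jb] := boolP (face_deg J <= b)%MM; last by rewrite cochain_coef_gt.
have /andP [JD _] := valP J.
set L : face fullSimplex q := exist _ (B :\: val J) (compl_face e Jb).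
have eL : (setmnm (val J) + face_deg L)%MM = b by exact: setmnm_suppD.
rewrite (cochain_coef_face _ eL) ffunE sr_coef_pi // raddf_sum (bigD1 J) ?eL //=.
rewrite mcoeffZ mcoeffX eqxx mulr1 big1 ?addr0 // => J' /andP [_ ne].
by rewrite mcoeffZ mcoeffX face_deg_inj (negbTE ne) mulr0.
Qed.

Lemma cochain_homog i q (c : face Delta i -> k) : gproj b (cochain q c) = cochain q c.
Proof.
apply/ffunP => L; rewrite !ffunE; case: ifP => h.
  rewrite /= pi_proj /=; congr (\pi _).
  have e := raddf_sum (gproj (g := P) (b - face_deg L)).
  rewrite -[LHS]/(gproj (g := P) (b - face_deg L) _) raddf_sum.
  apply: eq_bigr => J /eqP eJ /=.
  have -> : (b - face_deg L)%MM = face_deg J by rewrite -eJ addmK.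
  exact: poly_projZX.
rewrite big_pred0 ?raddf0 // => J; apply/negP => /eqP eJ; case/negP: h.
by rewrite -eJ lem_addl.
Qed.

Lemma cochain_coef_eq0 i q (t : tensor Kf A q) : i + q = (mdeg b)%:Z ->
  (forall J : face Delta i, cochain_coef (val J) t = 0) -> gproj b t = 0.
Proof.
move=> e h; apply/ffunP => L; rewrite !ffunE; case: ifP => // Lb.
have e1 : (setmnm (B :\: val L) + face_deg L)%MM = b by rewrite addmC; exact: setmnm_suppD.
have -> : (b - bdeg Kf q L)%MM = setmnm (B :\: val L) by rewrite -[in LHS]e1 addmK.
have [JD|JD] := boolP (B :\: val L \in faces Delta); last exact: sr_gproj_nonface.
have JP : (B :\: val L \in faces Delta) && (#|B :\: val L|%:Z == i).
  rewrite JD /=; have /andP [_ /eqP Lc] := valP L; apply/eqP/(addIr q).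
  by rewrite e -[in RHS]e1 mdegD !mdeg_setmnm PoszD Lc.
apply: sr_gproj_face => //; rewrite -(cochain_coef_face _ e1).
exact: (h (exist _ (B :\: val L) JP)).
Qed.

End SR.
End Cochains.

(** * Duality for matrices *)
Section LinearAlgebra.
Lemma sum_enum_val (V : nmodType) (Y : finType) (G : Y -> V) :
  \sum_y G y = \sum_(i < #|Y|) G (enum_val i).
Proof. exact: big_enum_val. Qed.

Variables (k : fieldType) (X Y : finType) (D : X -> Y -> k).

(** A vector outside the row space is detected by a column of the cokernel
    matrix. *)
Lemma in_row_span (z : Y -> k) :
  (forall t : Y -> k, (forall x, \sum_y D x y * t y = 0) -> \sum_y z y * t y = 0) ->
  exists c : X -> k, forall y, z y = \sum_x c x * D x y.
Proof.
move=> h; pose M : 'M[k]_(#|X|, #|Y|) := \matrix_(i, j) D (enum_val i) (enum_val j).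
have ME i j : M i j = D (enum_val i) (enum_val j) by rewrite mxE.
pose r : 'rV[k]_#|Y| := \row_j z (enum_val j).
have : (r <= M)%MS.
  rewrite submxE; apply/eqP/matrixP => i j; rewrite [RHS]mxE.
  have := h (fun y => cokermx M (enum_rank y) j).
  rewrite sum_enum_val mxE => e.
  apply: etrans (e _).
    by apply: eq_bigr => l _; rewrite mxE enum_valK.
  move=> x; have e0 : (M *m cokermx M) (enum_rank x) j = 0 by rewrite mulmx_coker mxE.
  rewrite sum_enum_val -[RHS]e0 mxE; apply: eq_bigr => l _.
  by rewrite ME enum_rankK enum_valK.
case/submxP => C eC; exists (fun x => C 0 (enum_rank x)) => y.
have e0 : r 0 (enum_rank y) = (C *m M) 0 (enum_rank y) by rewrite eC.
rewrite mxE [RHS]mxE enum_rankK in e0; rewrite e0 [RHS]sum_enum_val; apply: eq_bigr => l _.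
by rewrite ME enum_rankK enum_valK.
Qed.

Definition right_ker (t : Y -> k) := forall x, \sum_y D x y * t y = 0.

(** The matrix [pinvmx] expresses a kernel vector linearly through the rows of
    [kermx], and phi is evaluated on these rows. *)
Lemma extend_functional (phi : (Y -> k) -> k) :
  (forall a t t', right_ker t -> right_ker t' ->
     phi (fun y => a * t y + t' y) = a * phi t + phi t') ->
  exists z : Y -> k, forall t, right_ker t -> phi t = \sum_y z y * t y.
Proof.
move=> hphi; pose M : 'M[k]_(#|Y|, #|X|) := \matrix_(j, i) D (enum_val i) (enum_val j).
have ME i j : M i j = D (enum_val j) (enum_val i) by rewrite mxE.
pose K := kermx M; pose row r y := K r (enum_rank y).
have row_ker r : right_ker (row r).
  move=> x; have e0 : (K *m M) r (enum_rank x) = 0 by rewrite mulmx_ker mxE.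
  rewrite sum_enum_val -[RHS]e0 mxE; apply: eq_bigr => l _.
  by rewrite /row ME enum_rankK enum_valK mulrC.
have ker0 : right_ker (fun _ => 0) by move=> x; rewrite big1 // => y _; rewrite mulr0.
have phi0 : phi (fun _ => 0) = 0.
  have := hphi 1 _ _ ker0 ker0.
  have -> : (fun y : Y => 1 * 0 + 0) = (fun _ => 0) :> (Y -> k).
    by apply/funext => y; rewrite mulr0 addr0.
  by rewrite mul1r => e; apply/(addrI (phi (fun _ => 0))); rewrite -e addr0.
have phi_sum (s : 'I_#|Y| -> k) (rs : seq 'I_#|Y|) :
    right_ker (fun y => \sum_(r <- rs) s r * row r y) /\
    phi (fun y => \sum_(r <- rs) s r * row r y) = \sum_(r <- rs) s r * phi (row r).
  elim: rs => [|r rs [IH1 IH2]].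
    have -> : (fun y => \sum_(r <- [::]) s r * row r y) = (fun _ => 0).
      by apply/funext => y; rewrite big_nil.
    by rewrite big_nil.
  have -> : (fun y => \sum_(r <- r :: rs) s r * row r y)
      = (fun y => s r * row r y + \sum_(r <- rs) s r * row r y).
    by apply/funext => y; rewrite big_cons.
  split; last by rewrite hphi // IH2 big_cons.
  move=> x; under eq_bigr do rewrite mulrDr.
  rewrite big_split /= IH1 addr0.
  under eq_bigr do rewrite mulrCA.
  by rewrite -mulr_sumr row_ker mulr0.
exists (fun y => \sum_r pinvmx K (enum_rank y) r * phi (row r)) => t tker.
pose tr : 'rV[k]_#|Y| := \row_j t (enum_val j).
have trK : (tr <= K)%MS.
  apply/sub_kermxP/matrixP => i j;
    rewrite mxE [RHS]mxE -[RHS](tker (enum_val j)) [RHS]sum_enum_val.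
  by apply: eq_bigr => l _; rewrite mxE ME mulrC.
have et : t = (fun y => \sum_r (tr *m pinvmx K) 0 r * row r y).
  apply/funext => y; have e0 : (tr *m pinvmx K *m K) 0 (enum_rank y) = tr 0 (enum_rank y).
    by rewrite mulmxKpV.
  by rewrite mxE [RHS]mxE enum_rankK in e0; rewrite -e0.
rewrite {1}et (phi_sum _ _).2; under [RHS]eq_bigr do rewrite mulr_suml.
rewrite exchange_big; apply: eq_bigr => r _; rewrite mxE mulr_suml [RHS]sum_enum_val.
by apply: eq_bigr => l _; rewrite mxE enum_valK; ring.
Qed.

End LinearAlgebra.

(** * The Koszul complex is a resolution of the residue field *)
Section KoszulResolution.
Variables (k : fieldType) (n : nat).
Local Notation S := {mpoly k[n]}.
Local Notation P := (polyModule k n).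
Local Notation full := (fullSimplex n).
Local Notation Kf := (koszulComplex k full).

Section Degree.
Variable b : 'X_{1..n}.

(** Coordinates indexed by all sets, so that the cone below can remove a vertex
    without a proof that the result has the right cardinality. *)
Definition chain_coef_set j (z : tensor Kf P j) (J : {set 'I_n}) : k :=
  if insub J is Some J' then chain_coef b (J' : face full j) z else 0.

Lemma chain_coef_face_set j z (J : face full j) :
  chain_coef_set z (val J) = chain_coef b J z.
Proof. by rewrite /chain_coef_set valK. Qed.

Lemma incidence_sum i (g : {set 'I_n} -> k) (J : {set 'I_n}) : #|J|%:Z + 1 = i ->
  \sum_(J' : face full i) incidence k b (val J') J * g (val J')
    = \sum_(v | (v \notin J) && (setmnm (v |: J) <= b)%MM)
        (-1) ^+ ksign (v |: J) v * g (v |: J).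
Proof.
move=> ei; rewrite (@sum_face _ _ full _ (fun J' => incidence k b J' J * g J')).
transitivity (\sum_(J' : {set 'I_n})
    \sum_(v | [&& v \in J', J' :\ v == J & (setmnm J' <= b)%MM])
      (-1) ^+ ksign J' v * g J').
  rewrite big_mkcond; apply: eq_bigr => J' _; rewrite inE /= /incidence.
  case: ifP => cJ'.
    case: ifP => J'b; last by rewrite mul0r big_pred0 // => v; rewrite !andbF.
    by rewrite mulr_suml; apply: eq_bigl => v; rewrite andbT.
  rewrite big_pred0 // => v; apply/negP => /and3P [vJ' /eqP eJ _]; case/negP: cJ'.
  by rewrite -ei -eJ (cardsD1 v J') vJ' intS addrC.
rewrite (exchange_big_dep (fun v => (v \notin J) && (setmnm (v |: J) <= b)%MM)) /=;
  last first.
  move=> J' v _ /and3P [vJ' /eqP <- J'b]; rewrite setD1K // J'b.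
  by rewrite !inE eqxx.
apply: eq_bigr => v /andP [vJ vJb]; rewrite (big_pred1 (v |: J)) // => J'.
apply/and3P/eqP => [[vJ' /eqP <- _]|->]; first by rewrite setD1K.
by rewrite setU11 setU1K.
Qed.

(** In degree b the complex is that of the full simplex on the support of b, and
    the cone over a vertex l0 contracts it.  Taking l0 to be the least vertex
    makes the sign of l0 equal to 1 in every face that contains it. *)
Lemma koszul_exact_degree i j l (eij : i = j + 1) (ejl : j = l + 1)
    (z : tensor Kf P j) : b != 0%MM -> tdiff Kf P ejl z = 0 ->
  exists y, tdiff Kf P eij y = gproj b z.
Proof.
move=> b0 dz.
have [l0 bl0 l0min] : exists2 l0 : 'I_n,
    (0 < b l0)%N & forall l, (0 < b l)%N -> (l0 <= l)%N.
  have [m hm] : exists l1 : 'I_n, (0 < b l1)%N.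
    apply/existsP; apply: contraNT b0 => /existsPn h; apply/eqP/mnmP => l1.
    by rewrite mnmE; have := h l1; case: (b l1).
  by case: (@arg_minnP _ m (fun l1 : 'I_n => 0 < b l1)%N (@nat_of_ord n) hm)
    => l0 h1 h2; exists l0.
(* the cone over the cycle z *)
pose beta (J : {set 'I_n}) := if l0 \in J then chain_coef_set z (J :\ l0) else 0.
exists (gproj b (chain b (fun J : face full i => beta (val J)))).
apply/eqP; rewrite -subr_eq0 ghomP -raddfB; apply/eqP; apply: chain_coef_eq0 => J.
rewrite chain_coef_sub; apply/eqP; rewrite subr_eq0; apply/eqP.
have [Jb|Jb] := boolP (face_deg J <= b)%MM; last by rewrite /chain_coef (negbTE Jb).
have /andP [_ /eqP Jc] := valP J.
have -> : chain_coef b J (tdiff Kf P eij (chain b (fun J : face full i => beta (val J))))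
    = \sum_(v | (v \notin val J) && (setmnm (v |: val J) <= b)%MM)
        (-1) ^+ ksign (v |: val J) v * beta (v |: val J).
  rewrite chain_coef_tdiff -(@incidence_sum i); last first.
    by apply: etrans (esym eij); congr (_ + _).
  apply: eq_bigr => J' _; rewrite chain_coef_chain /incidence -[setmnm _]/(face_deg J').
  by case: (face_deg J' <= b)%MM; rewrite ?mul0r.
have l0lt v : (0 < b v)%N -> v != l0 -> (l0 < v)%N.
  by move=> bv ne; rewrite ltn_neqAle l0min // eq_sym ne.
rewrite -chain_coef_face_set.
(* if l0 is not in J, only v = l0 contributes; if it is, the remaining terms are
   those of the cycle condition at J0, with opposite sign *)
have [l0J|l0J] := boolP (l0 \in val J); last first.
  have l0Jb : (setmnm (l0 |: val J) <= b)%MM.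
    apply/setmnm_le => v; rewrite !inE => /orP [/eqP -> //|].
    by move/setmnm_le: Jb; apply.
  rewrite (bigD1 l0) ?l0J //= big1 => [|v /andP [_ ne]]; last first.
    by rewrite /beta !inE eq_sym (negbTE ne) (negbTE l0J) mulr0.
  have -> : ksign (l0 |: val J) l0 = 0%N.
    apply/eqP; rewrite cards_eq0; apply/eqP/setP => v; rewrite !inE.
    apply/negP => /andP [/orP [/eqP ->|vJ]]; rewrite ?ltnn // ltnNge l0min //.
    by move/setmnm_le: Jb; apply.
  by rewrite expr0 mul1r addr0 /beta setU11 setU1K.
pose J0 := val J :\ l0.
have J0c : #|J0|%:Z + 1 = j.
  by apply: etrans Jc; rewrite (cardsD1 l0 (val J)) l0J intS addrC.
have J0P : (J0 \in faces full) && (#|J0|%:Z == l).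
  by rewrite inE /=; apply/eqP/(addIr 1); rewrite J0c ejl.
have cyc : \sum_(v | (v \notin J0) && (setmnm (v |: J0) <= b)%MM)
    (-1) ^+ ksign (v |: J0) v * chain_coef_set z (v |: J0) = 0.
  rewrite -(@incidence_sum j) //.
  transitivity (chain_coef b (exist _ J0 J0P : face full l) (tdiff Kf P ejl z)).
    by rewrite chain_coef_tdiff; apply: eq_bigr => J' _; rewrite chain_coef_face_set.
  by rewrite dz /chain_coef ffunE mcoeff0 if_same.
have l0J0 : l0 |: J0 = val J by rewrite setD1K.
move: cyc; rewrite (bigD1 l0) /=; last by rewrite l0J0 Jb !inE eqxx.
have -> : ksign (l0 |: J0) l0 = 0%N.
  rewrite l0J0; apply/eqP; rewrite cards_eq0; apply/eqP/setP => v; rewrite !inE.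
  apply/negP => /andP [vJ]; rewrite ltnNge l0min //.
  by move/setmnm_le: Jb; apply.
rewrite expr0 mul1r l0J0 => /eqP; rewrite addrC addr_eq0 => /eqP e.
apply: oppr_inj; rewrite -e -sumrN.
apply: eq_big => v.
  rewrite !inE; case: (eqVneq v l0) => [->|ne] /=; first by rewrite l0J /= andbF.
  rewrite andbT; congr (_ && _); rewrite -l0J0; apply/setmnm_le/setmnm_le => h x xJ.
    by apply: h; move: xJ; rewrite !inE; case: (x == v); rewrite //= => ->; rewrite orbT.
  case: (eqVneq x l0) => [->//|nx]; apply: h; move: xJ; rewrite !inE (negbTE nx) /=.
  by [].
move=> /andP [vJ vJb].
have ne : v != l0 by apply: contraNneq vJ => ->.
have bv : (0 < b v)%N by move/setmnm_le: vJb; apply; rewrite setU11.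
rewrite /beta !inE l0J orbT.
have -> : (v |: val J) :\ l0 = v |: J0.
  by apply/setP=> x; rewrite !inE; case: (eqVneq x v) => [->|] //=; rewrite ne.
have -> : ksign (v |: val J) v = (ksign (v |: J0) v).+1.
  rewrite /ksign (cardsD1 l0) !inE l0J orbT l0lt // add1n; congr _.+1; apply: eq_card => x.
  by rewrite !inE; case: (eqVneq x l0) => [->|] //=; rewrite eq_sym (negbTE ne).
by rewrite exprS mulN1r mulNr opprK.
Qed.
End Degree.

(** Degree 0 is the only degree in which the complex has homology; there only
    v_(empty set) occurs, so the condition on z is void if j > 0. *)
Lemma koszul_exact i j l (eij : i = j + 1) (ejl : j = l + 1) (z : tensor Kf P j) :
  gproj 0%MM z = 0 -> tdiff Kf P ejl z = 0 -> exists y, tdiff Kf P eij y = z.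
Proof.
move=> z0 dz; have [s [_ ez]] := gproj_sum z.
rewrite {}[in X in exists y, _ = X]ez; elim: s => [|b s [y ey]].
  by exists 0; rewrite raddf0 big_nil.
have [y' ey'] : exists y, tdiff Kf P eij y = gproj b z.
  have [->|b0] := eqVneq b 0%MM; last exact: koszul_exact_degree b0 dz.
  by exists 0; rewrite raddf0 z0.
by exists (y' + y); rewrite raddfD /= ey' ey big_cons.
Qed.

Local Notation kk := (residueField k n).
Local Notation mI := (monIdeal k (fun i : 'I_n => U_(i)%MM)).
Local Notation piK := (\pi_(quot_of mI) : S -> kk).

Definition koszul_aug_fun (z : tensor Kf P 0) : kk := piK (\sum_J (z J : S)).

Fact koszul_aug_linear : linear koszul_aug_fun.
Proof.
move=> a x y; rewrite /koszul_aug_fun.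
have -> : \sum_J ((a *: x + y) J : S) = a * (\sum_J (x J : S)) + \sum_J (y J : S).
  rewrite mulr_sumr -big_split; apply: eq_bigr => J _ /=.
  by rewrite !ffunE.
by rewrite raddfD; congr (_ + _); exact: linearZ.
Qed.
HB.instance Definition _ := GRing.isLinear.Build S (tensor Kf P 0) kk *:%R
  koszul_aug_fun koszul_aug_linear.

Lemma face0 (J : face full 0) : val J = set0.
Proof. by have /andP [_ /eqP [/cards0_eq]] := valP J. Qed.

Lemma face0_deg (J : face full 0) : face_deg J = 0%MM.
Proof. by apply/mnmP => l; rewrite /face_deg face0 !mnmE inE. Qed.

Fact koszul_augP b z : koszul_aug_fun (gproj b z) = gproj b (koszul_aug_fun z).
Proof.
rewrite /koszul_aug_fun /= pi_proj /=; congr (\pi _).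
rewrite -[RHS]/(gproj (g := P) b _) raddf_sum; apply: eq_bigr => J _.
rewrite ffunE /= face0_deg subm0.
by have -> : (0 <= b)%MM by apply/mnm_lepP => l; rewrite mnmE.
Qed.
Definition koszul_aug : gradedHom (tensor Kf P 0) kk :=
  @GradedHom k n (tensor Kf P 0) kk koszul_aug_fun koszul_augP.

Fact koszul_neg j : j < 0 -> #|basis Kf j| = 0%N.
Proof.
case: j => // m _; apply/eqP; rewrite -leqn0 leqNgt; apply/card_gt0P => -[J _].
by have /andP [_ /eqP] := valP J.
Qed.

Fact koszul_aug_surj (y : kk) : exists u, koszul_aug u = y.
Proof.
elim/quot_ind: y => p; exists [ffun=> p]; rewrite /= /koszul_aug_fun; congr (\pi _).
have P0 : (set0 \in faces full) && (#|set0 :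
  {set 'I_n}|%:Z == 0 :> int) by rewrite cards0 inE.
rewrite (big_pred1 (exist _ set0 P0 : face full 0)) ?ffunE // => J.
by apply/esym/eqP/val_inj; rewrite face0.
Qed.

Fact koszul_aug_exact (e : 1 = 0 + 1) u : koszul_aug u = 0 <->
  exists v, @tdiff k n Kf P 1 0 e v = u.
Proof.
split=> [h|[v <-]].
  have e' : 0 = -1 + 1 :> int by [].
  apply: (koszul_exact e (ejl := e')); last first.
    by apply/ffunP=> J; have /andP [_ /eqP] := valP J.
  have : \sum_J (u J : S) \in submod_pred mI.
    have /quot_eqP : piK (\sum_J (u J : S)) = piK 0 by rewrite raddf0.
    by rewrite subr0.
  rewrite unfold_in => /asboolP [c ec]; apply/ffunP => J; rewrite !ffunE /= face0_deg.
  rewrite lepm_refl subm0 /= /poly_proj.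
  have e0 : (\sum_J (u J : S))@_0 = 0.
    rewrite ec raddf_sum big1 // => i _; rewrite mulrC /= mcoeffXM.
    by rewrite mnmE.
  have -> : (u J : S) = \sum_J (u J : S).
    rewrite (big_pred1 J) // => J'; apply/esym/eqP/val_inj; by rewrite !face0.
  by rewrite e0 scale0r.
rewrite /= /koszul_aug_fun; apply: etrans (raddf0 (\pi_(quot_of mI))); apply/quot_eqP.
rewrite subr0; apply: rpred_sum => J _; rewrite ffunE; apply: rpred_sum => J' _ /=.
rewrite /koszul_diff; case: koszul_coefP => [|v' _ _]; first by rewrite scale0r;
  exact: (submod_closedP mI).1.
rewrite unfold_in; apply/asboolP.
exists (fun i => (i == v')%:R * ((-1) ^+ #|[set l in val J' | (l < v')%N]| * (v J' : S))).
rewrite (bigD1 v') //= eqxx mul1r big1 ?addr0 => [|i /negbTE ->]; last by rewrite !mul0r.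
exact: mulrAC.
Qed.

(** For j > 0 no basis element has degree 0, so a cycle has no component of
    degree 0. *)
Fact koszul_res_exact i j l (eij : i = j + 1) (ejl : j = l + 1) : 0 < j ->
  forall u, tdiff Kf P ejl u = 0 <-> exists v, tdiff Kf P eij v = u.
Proof.
move=> j0 u; split=> [h|[v <-]]; last exact: tdiffK.
apply: koszul_exact h; apply/ffunP => J; rewrite !ffunE.
case: ifP => // /mnm_lepP h; have /andP [_ /eqP Jc] := valP J.
have : val J = set0.
  by apply/setP=> x; have := h x; rewrite /= /face_deg !mnmE inE; case: (x \in val J).
move=> J0; have e0 : j = 0 by apply: etrans (esym Jc) _; rewrite J0 cards0.
by exfalso; clear -e0 j0; rewrite e0 in j0.
Qed.

Definition koszulResolution : freeResolution kk :=
  @FreeResolution k n kk Kf koszul_aug koszul_neg koszul_aug_surj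
    koszul_aug_exact koszul_res_exact.

End KoszulResolution.

(** * The pairing of chains and cochains *)
Section Pairing.
Variables (k : fieldType) (n : nat) (Delta : simplicialComplex n).
Variable b : 'X_{1..n}.
Hypothesis b_sqfree : forall l : 'I_n, (b l <= 1)%N.
Local Notation S := {mpoly k[n]}.
Local Notation P := (polyModule k n).
Local Notation A := (stanleyReisner k Delta).
Local Notation K := (koszulComplex k Delta).
Local Notation Kf := (koszulComplex k (fullSimplex n)).

Definition dual_coef i q (J : face Delta i) (t : tensor Kf A q) : k :=
  dual_sign k b (val J) * cochain_coef b (val J) t.

Definition pairing i q (z : tensor K P i) (t : tensor Kf A q) : k :=
  \sum_(J : face Delta i) chain_coef b J z * dual_coef J t.

Lemma face_in i (J : face Delta i) : val J \in faces Delta.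
Proof. by case/andP: (valP J). Qed.

Lemma dual_coef_lin i q (J : face Delta i) a (t t' : tensor Kf A q) :
  dual_coef J (a%:MP *: t + t') = a * dual_coef J t + dual_coef J t'.
Proof. by rewrite /dual_coef cochain_coef_lin ?face_in // mulrDr mulrCA. Qed.

Lemma pairing_linl i q a (z z' : tensor K P i) (t : tensor Kf A q) :
  pairing (a%:MP *: z + z') t = a * pairing z t + pairing z' t.
Proof.
rewrite /pairing mulr_sumr -big_split; apply: eq_bigr => J _ /=.
by rewrite chain_coef_lin mulrDl -mulrA.
Qed.

Lemma pairing_linr i q a (z : tensor K P i) (t t' : tensor Kf A q) :
  pairing z (a%:MP *: t + t') = a * pairing z t + pairing z t'.
Proof.
rewrite /pairing mulr_sumr -big_split; apply: eq_bigr => J _ /=.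
by rewrite dual_coef_lin mulrDr mulrCA.
Qed.

Lemma pairing_subl i q (z z' : tensor K P i) (t : tensor Kf A q) :
  pairing (z - z') t = pairing z t - pairing z' t.
Proof. by rewrite /pairing -sumrB; apply: eq_bigr => J _;
  rewrite chain_coef_sub mulrBl. Qed.

Lemma pairing_subr i q (z : tensor K P i) (t t' : tensor Kf A q) :
  pairing z (t - t') = pairing z t - pairing z t'.
Proof.
rewrite /pairing -sumrB; apply: eq_bigr => J _.
by rewrite /dual_coef cochain_coef_sub ?face_in // !mulrBr.
Qed.

Lemma pairing_0l i q (t : tensor Kf A q) : pairing (0 : tensor K P i) t = 0.
Proof. by rewrite -(subrr (0 : tensor K P i)) pairing_subl subrr. Qed.

Lemma pairing_0r i q (z : tensor K P i) : pairing z (0 : tensor Kf A q) = 0.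
Proof. by rewrite -(subrr (0 : tensor Kf A q)) pairing_subr subrr. Qed.

Lemma pairing_adjoint i i' p q (ei : i' = i + 1) (e : p = q + 1)
    (z : tensor K P i') (t : tensor Kf A p) : i' + q = (mdeg b)%:Z ->
  pairing (tdiff K P ei z) t = pairing z (tdiff Kf A e t).
Proof.
move=> eq; rewrite /pairing.
under eq_bigr do rewrite chain_coef_tdiff mulr_suml.
rewrite exchange_big; apply: eq_bigr => J' _.
rewrite /dual_coef (cochain_coef_tdiff b_sqfree ei e _ _ eq) mulr_sumr.
by apply: eq_bigr => J _; rewrite mulrAC mulrC; ring.
Qed.

Lemma pairing_homologousl i i' p q (ei : i' = i + 1) (e : p = q + 1) z z'
    (t : tensor Kf A p) : i' + q = (mdeg b)%:Z ->
  homologous (tdiff K P ei) z z' -> tdiff Kf A e t = 0 -> pairing z t = pairing z' t.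
Proof.
move=> eq [v ev] dt; apply/eqP; rewrite -subr_eq0 -pairing_subl -ev.
by rewrite (pairing_adjoint ei e) // dt pairing_0r.
Qed.

Lemma pairing_homologousr i i' p q (ei : i' = i + 1) (e : p = q + 1) (z : tensor K P i')
    t t' : i' + q = (mdeg b)%:Z ->
  homologous (tdiff Kf A e) t t' -> tdiff K P ei z = 0 -> pairing z t = pairing z t'.
Proof.
move=> eq [v ev] dz; apply/eqP; rewrite -subr_eq0 -pairing_subr -ev.
by rewrite -(pairing_adjoint ei e) // dz pairing_0l.
Qed.

Lemma pairing_gprojl i q (z : tensor K P i) (t : tensor Kf A q) :
  pairing (gproj b z) t = pairing z t.
Proof. by apply: eq_bigr => J _; rewrite chain_coef_gproj. Qed.

Section Coords.
Variables (i i' p q : int) (ei : i' = i + 1) (e : p = q + 1).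
Hypothesis eq : i' + q = (mdeg b)%:Z.

Let ep : i + p = (mdeg b)%:Z.
Proof. by rewrite e addrCA -eq ei addrA [in RHS]addrC addrA [q + _]addrC. Qed.

Lemma cochain_eq (t t' : tensor Kf A p) : gproj b t = t -> gproj b t' = t' ->
  (forall J : face Delta i, dual_coef J t = dual_coef J t') -> t = t'.
Proof.
move=> ht ht' h; apply/eqP; rewrite -subr_eq0 -(homog_sub ht ht'); apply/eqP.
apply: (cochain_coef_eq0 b_sqfree ep) => J; rewrite cochain_coef_sub ?face_in //.
by apply/eqP; rewrite subr_eq0; apply/eqP/(mulfI (dual_sign_neq0 k b (val J)))/h.
Qed.

Definition dual_cochain (c : face Delta i -> k) : tensor Kf A p :=
  cochain b p (fun J => (dual_sign k b (val J))^-1 * c J).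

Lemma dual_cochain_homog c : gproj b (dual_cochain c) = dual_cochain c.
Proof. exact: cochain_homog. Qed.

Lemma dual_coef_dual_cochain c J :
  dual_coef J (dual_cochain c) = if (face_deg J <= b)%MM then c J else 0.
Proof.
rewrite /dual_coef (cochain_coef_cochain b_sqfree _ _ ep); case: ifP;
  rewrite ?mulr0 // => _.
by rewrite mulVKf // dual_sign_neq0.
Qed.

Lemma incidence_supp J' (J : face Delta i) (x : k) :
  incidence k b J' (val J) * (if (face_deg J <= b)%MM then x else 0)
    = incidence k b J' (val J) * x.
Proof.
case: ifP => // h.
by rewrite incidence_eq0 ?mul0r // -[setmnm _]/(face_deg J) h.
Qed.

Lemma dual_cochain_cycle c :
  right_ker (fun (J' : face Delta i') (J :
    face Delta i) => incidence k b (val J') (val J)) c ->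
  tdiff Kf A e (dual_cochain c) = 0.
Proof.
move=> h; rewrite -dual_cochain_homog ghomP.
apply: (cochain_coef_eq0 b_sqfree eq) => J'; apply: (mulfI (dual_sign_neq0 k b (val J'))).
rewrite mulr0 (cochain_coef_tdiff b_sqfree ei e _ _ eq) -[RHS](h J').
apply: eq_bigr => J _; rewrite -[_ * cochain_coef _ _ _]/(dual_coef J (dual_cochain c)).
by rewrite dual_coef_dual_cochain incidence_supp.
Qed.

Lemma cycle_dual_coef t : tdiff Kf A e t = 0 ->
  right_ker (fun (J' : face Delta i') (J : face Delta i) => incidence k b (val J') (val J))
    (fun J => dual_coef J t).
Proof.
by move=> dt J'; rewrite -(cochain_coef_tdiff b_sqfree ei e _ _ eq) dt
  cochain_coef_zero ?face_in // mulr0.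
Qed.

(** The coordinates of z are orthogonal to the kernel of the incidence matrix,
    hence lie in its row space, and combinations of rows are coordinates of
    boundaries. *)
Lemma pairing_separates (z : tensor K P i) : gproj b z = z ->
  (forall t : tensor Kf A p, tdiff Kf A e t = 0 -> gproj b t = t -> pairing z t = 0) ->
  exists y, tdiff K P ei y = z.
Proof.
move=> hz h.
have [t ht|c ec] := @in_row_span k (face Delta i') (face Delta i)
    (fun J' J => incidence k b (val J') (val J)) (fun J => chain_coef b J z).
  rewrite -[RHS](h (dual_cochain t) (dual_cochain_cycle ht) (dual_cochain_homog t)).
  apply: eq_bigr => J _; rewrite dual_coef_dual_cochain /chain_coef.
  by case: ifP => // _; rewrite !mul0r.
exists (chain b c); apply/eqP; rewrite -subr_eq0 -hz -(chain_homog b c) ghomP -raddfB.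
apply/eqP; apply: chain_coef_eq0 => J; rewrite chain_coef_sub; apply/eqP;
  rewrite subr_eq0; apply/eqP.
rewrite chain_coef_tdiff ec; apply: eq_bigr => J' _; rewrite chain_coef_chain mulrC.
rewrite /incidence -[setmnm _]/(face_deg J').
by case: ifP => // _; rewrite !(mul0r, mulr0).
Qed.

(** Extend phi from cocycles to all coordinate vectors; the extension is given
    by a coordinate vector of chains. *)
Lemma pairing_represents (phi : tensor Kf A p -> k) :
  (forall a t t', tdiff Kf A e t = 0 -> gproj b t = t -> tdiff Kf A e t' = 0 ->
     gproj b t' = t' -> phi (a%:MP *: t + t') = a * phi t + phi t') ->
  exists z : tensor K P i, gproj b z = z /\
    forall t, tdiff Kf A e t = 0 -> gproj b t = t -> phi t = pairing z t.
Proof.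
move=> hphi.
have [a c c' hc hc'|z hz] := @extend_functional k (face Delta i') (face Delta i)
    (fun J' J => incidence k b (val J') (val J)) (fun c => phi (dual_cochain c)).
  rewrite -hphi ?dual_cochain_cycle ?dual_cochain_homog //; congr phi.
  apply: cochain_eq; first exact: dual_cochain_homog.
    by apply: homog_lin; apply: dual_cochain_homog.
  move=> J; rewrite dual_coef_lin !dual_coef_dual_cochain.
  by case: ifP; rewrite ?mulr0 ?addr0.
exists (chain b z); split=> [|t dt ht]; first exact: chain_homog.
have -> : t = dual_cochain (fun J => dual_coef J t).
  apply: cochain_eq => //; first exact: dual_cochain_homog.
  move=> J; rewrite dual_coef_dual_cochain; case: ifP => // h.
  by rewrite /dual_coef cochain_coef_gt ?mulr0 // -[setmnm _]/(face_deg J) h.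
rewrite hz; last exact: cycle_dual_coef.
apply: eq_bigr => J _; rewrite dual_coef_dual_cochain chain_coef_chain.
by case: ifP => // h;
  rewrite /dual_coef cochain_coef_gt ?mulr0 // -[setmnm _]/(face_deg J) h.
Qed.

Lemma pairing_eq0 (z : tensor K P i) :
  (forall t : tensor Kf A p, gproj b t = t -> pairing z t = 0) -> gproj b z = 0.
Proof.
move=> h; apply: chain_coef_eq0 => J.
rewrite -[RHS](h (dual_cochain (fun J' => (J' == J)%:R)) (dual_cochain_homog _)).
rewrite /pairing (bigD1 J) //= big1 => [|J' /negbTE ne].
  rewrite dual_coef_dual_cochain eqxx addr0 /chain_coef.
  by case: ifP => _; rewrite ?mulr1 ?mul0r.
by rewrite dual_coef_dual_cochain ne if_same mulr0.
Qed.

End Coords.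
End Pairing.

(** * The isomorphism *)
Section Duality.
Variables (k : fieldType) (n : nat).
Local Notation S := {mpoly k[n]}.
Local Notation P := (polyModule k n).
Local Notation Kf := (koszulComplex k (fullSimplex n)).
Variables (F : freeResolution (residueField k n)).
Variables (f : chainMap F Kf) (g : chainMap Kf F).
Hypothesis fgK : forall h i j (ehi : h = i + 1) (eij : i = j + 1) M,
  (forall u, tdiff F M eij u = 0 ->
     homologous (tdiff F M ehi) (tmap g M i (tmap f M i u)) u) /\
  (forall u, tdiff Kf M eij u = 0 ->
     homologous (tdiff Kf M ehi) (tmap f M i (tmap g M i u)) u).
Variable b : 'X_{1..n}.
Hypothesis b_sqfree : forall l : 'I_n, (b l <= 1)%N.
Variables (i q : int).
Hypothesis hq : i + q = (mdeg b)%:Z.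

Let hq' : i + 1 + (q - 1) = (mdeg b)%:Z.
Proof. by rewrite addrA addrAC -hq addrK addrC. Qed.

Section Fixed.
Variable Delta : simplicialComplex n.
Local Notation A := (stanleyReisner k Delta).
Local Notation K := (koszulComplex k Delta).
Local Notation Wb := (component (koszulModule k Delta i) b).
Local Notation Tb := (component (Tor F q A) b).
Local Notation dup C M j := (tdiff C M (erefl (j + 1))).
Local Notation ddown C M j := (tdiff C M (esym (subrK 1 j))).

Definition wrep (w : Wb) : tensor K P i := hrep (cval w : chomology K P i).
Definition trep (t : Tb) : tensor F A q := hrep (cval t : chomology F A q).

Definition tor_pairing (w : Wb) (t : Tb) : k^o :=
  pairing b (wrep w) (tmap f A q (trep t)).

Lemma wrep_cycle w : ddown K P i (wrep w) = 0.
Proof. exact: hrep_cycle. Qed.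

Lemma trep_cycle t : ddown F A q (trep t) = 0.
Proof. exact: hrep_cycle. Qed.

Lemma wrep_lin a w w' :
  homologous (dup K P i) (wrep (a *: w + w')) (a%:MP *: wrep w + wrep w').
Proof. exact: hrep_linear. Qed.

Lemma trep_lin a t t' :
  homologous (dup F A q) (trep (a *: t + t')) (a%:MP *: trep t + trep t').
Proof. exact: hrep_linear. Qed.

Lemma tmap_cycle (C D : freeComplex k n) (h : chainMap C D) M j l (e : j = l + 1) u :
  tdiff C M e u = 0 -> tdiff D M e (tmap h M j u) = 0.
Proof. by move=> du; rewrite tdiff_tmap du; apply: raddf0. Qed.

Lemma tmap_homologous (C D : freeComplex k n) (h : chainMap C D) M j l (e : j = l + 1) u v :
  homologous (tdiff C M e) u v -> homologous (tdiff D M e) (tmap h M l u) (tmap h M l v).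
Proof.
move=> huv; apply: (homologous_map (h' := tmap h M j) _ huv).
exact: tdiff_tmap.
Qed.

Lemma pairing_tor_r (z : tensor K P i) (u v : tensor F A q) : ddown K P i z = 0 ->
  homologous (dup F A q) u v -> pairing b z (tmap f A q u) = pairing b z (tmap f A q v).
Proof.
move=> dz huv.
exact: (pairing_homologousr b_sqfree hq (tmap_homologous f huv) dz).
Qed.

Lemma pairing_tor_l (z z' : tensor K P i) (t : tensor Kf A q) : ddown Kf A q t = 0 ->
  homologous (dup K P i) z z' -> pairing b z t = pairing b z' t.
Proof. by move=> dt hz; apply: (pairing_homologousl b_sqfree hq' hz dt). Qed.

Fact tor_pairing_linear_r w : linear (tor_pairing w).
Proof.
move=> a t t'.
apply: etrans (pairing_tor_r (wrep_cycle w) (trep_lin a t t')) _.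
apply: etrans (congr1 _ (ghom_lin (tmap f A q) _ _ _)) _.
exact: pairing_linr.
Qed.
HB.instance Definition _ w := GRing.isLinear.Build k Tb k^o *:%R
  (tor_pairing w) (tor_pairing_linear_r w).

Definition tor_dual (w : Wb) : dual Tb := tor_pairing w.

Fact tor_dual_linear : linear tor_dual.
Proof.
move=> a w w'; apply: dual_ext => t.
apply: etrans (pairing_tor_l (tmap_cycle f (trep_cycle t)) (wrep_lin a w w')) _.
exact: pairing_linl.
Qed.
HB.instance Definition _ := GRing.isLinear.Build k Wb (dual Tb) *:%R
  tor_dual tor_dual_linear.

(** If the class of z pairs to zero with Tor, then z is orthogonal to every
    cocycle t of the Koszul complex, because t is homologous to f (g t). *)
Lemma tor_dual_inj : injective tor_dual.
Proof.
suff inj0 w : tor_dual w = 0 -> w = 0.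
  by move=> w w' e; apply/eqP; rewrite -subr_eq0; apply/eqP/inj0; rewrite raddfB /= e subrr.
move=> w0; pose z := wrep w.
have [y ey] : exists y, dup K P i y = gproj b z.
  apply: (pairing_separates b_sqfree (erefl _) (e := esym (subrK 1 q)) hq').
    by rewrite gprojK eqxx.
  move=> t dt ht; rewrite pairing_gprojl.
  have [t' ht'] : exists t' : Tb, homologous (dup F A q) (trep t') (tmap g A q t).
    apply: component_rep; first exact: tmap_cycle dt.
    by rewrite -ghomP ht.
  have e1 : tor_pairing w t' = 0 by rewrite -[LHS]/(tor_dual w t') w0.
  rewrite -[RHS]e1 /tor_pairing (pairing_tor_r (wrep_cycle w) ht').
  have h := (fgK (erefl (q + 1)) (esym (subrK 1 q)) A).2 _ dt.
  by rewrite (pairing_homologousr b_sqfree hq h (wrep_cycle w)).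
apply: component_eq; apply: homologous_trans (hrep_homog w) _.
apply: homologous_trans (homologous_sym (@hrep0 _ _ _ _ _ _ _)).
by exists y; rewrite subr0.
Qed.

(** Transport phi along g to a functional on Koszul cocycles and represent it by
    a chain z.  As the functional vanishes on coboundaries, z is orthogonal to
    them, so that z is a cycle by adjointness. *)
Lemma tor_dual_surj (phi : dual Tb) : exists w, tor_dual w = phi.
Proof.
pose good (t : tensor Kf A q) := ddown Kf A q t = 0 /\ gproj b t = t.
have /choice [c hc] : forall t, exists c : Tb,
    good t -> homologous (dup F A q) (trep c) (tmap g A q t).
  move=> t; have [[dt ht]|ngt] := pselect (good t); last by exists 0.
  have [c hc] : exists c : Tb, homologous (dup F A q) (trep c) (tmap g A q t).
    apply: component_rep; first exact: tmap_cycle dt.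
    by rewrite -ghomP ht.
  by exists c.
have good_lin a t t' : good t -> good t' -> good (a%:MP *: t + t').
  move=> [dt ht] [dt' ht']; split; last exact: homog_lin.
  by rewrite ghom_lin dt dt' scaler0 addr0.
have [a t t' dt ht dt' ht'|z [hz phiz]] :=
    @pairing_represents _ _ Delta b b_sqfree _ _ _ _ (erefl (i + 1)) (esym (subrK 1 q)) hq'
      (fun t => phi (c t)).
  have gt : good t by []. have gt' : good t' by [].
  rewrite -[RHS]/(a *: phi (c t) + phi (c t')) -linearP; congr (phi _).
  apply: component_eq; apply: homologous_trans (hc _ (good_lin a _ _ gt gt')) _.
  rewrite ghom_lin; apply: homologous_sym; apply: homologous_trans (trep_lin _ _ _) _.
  by apply: homologous_lin; apply: hc.
have dz : ddown K P i z = 0.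
  rewrite -hz ghomP; apply: (pairing_eq0 b_sqfree (esym (subrK 1 i)) (erefl (q + 1)) hq).
  move=> s hs; rewrite (pairing_adjoint b_sqfree _ (erefl (q + 1))) //.
  have gds : good (dup Kf A q s).
    by split; [exact: tdiffK | rewrite -ghomP hs].
  rewrite -phiz ?gds.1 ?gds.2 //.
  have -> : c (dup Kf A q s) = 0; last exact: raddf0.
  apply: component_eq; apply: homologous_trans (hc _ gds) _.
  apply: homologous_trans (homologous_sym (@hrep0 _ _ _ _ _ _ _)).
  by exists (tmap g A (q + 1) s); rewrite tdiff_tmap subr0.
have [w hw] : exists w : Wb, homologous (dup K P i) (wrep w) z.
  exact: component_rep.
exists w; apply: dual_ext => t; rewrite -[LHS]/(pairing b (wrep w) (tmap f A q (trep t))).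
rewrite (pairing_tor_l (tmap_cycle f (trep_cycle t)) hw).
rewrite (pairing_tor_r dz (hrep_homog t)).
set u := gproj b _.
have du : ddown F A q u = 0 by rewrite /u ghomP trep_cycle raddf0.
have gu : good (tmap f A q u).
  split; first exact: tmap_cycle du.
  by rewrite -ghomP /u gprojK eqxx.
rewrite -phiz ?gu.1 ?gu.2 //; congr (phi _).
apply: component_eq; apply: homologous_trans (hc _ gu) _.
apply: homologous_trans ((fgK (erefl (q + 1)) (esym (subrK 1 q)) A).1 _ du) _.
exact: homologous_sym (hrep_homog t).
Qed.

Lemma tor_dual_bij : bijective tor_dual.
Proof.
have [h hK] := choice tor_dual_surj.
by exists h => // w; apply: tor_dual_inj; rewrite hK.
Qed.

End Fixed.

Section Natural.
Variables (Delta Delta' : simplicialComplex n).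
Hypothesis sub : faces Delta \subset faces Delta'.
Local Notation A := (stanleyReisner k Delta).
Local Notation A' := (stanleyReisner k Delta').
Local Notation pr := (SR_proj k sub).

Lemma sr_coef_proj J (x : A') : J \in faces Delta ->
  sr_coef J (pr x) = sr_coef J x.
Proof.
move=> JD; have JD' := subsetP sub _ JD.
have [p ->] := sr_piP x; rewrite /= (SR_proj_pi sub).
exact: etrans (sr_coef_pi p JD) (esym (sr_coef_pi p JD')).
Qed.

Lemma chain_coef_incl j (J' : face Delta' j) (z : tensor (koszulComplex k Delta) P j) :
  chain_coef b J' (tmap (koszul_incl k sub) P j z)
    = \sum_(J : face Delta j) (val J == val J')%:R * chain_coef b J z.
Proof.
rewrite /chain_coef; case: ifP => J'b; last first.
  rewrite big1 // => J _; case: eqP => [eJ|_]; last by rewrite mul0r.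
  by rewrite /face_deg eJ -[setmnm _]/(face_deg J') J'b mulr0.
rewrite ffunE raddf_sum; apply: eq_bigr => J _; rewrite /= /face_incl.
case: eqP => [eJ|_]; last by rewrite mul0r scale0r mcoeff0.
by rewrite /face_deg eJ -[setmnm _]/(face_deg J') J'b scale1r mul1r.
Qed.

(** The inclusion of chains is adjoint to the restriction of cochains, because a
    chain of Delta has no coordinates at faces of Delta' outside Delta. *)
Lemma pairing_natural j p (z : tensor (koszulComplex k Delta) P j) (t : tensor Kf A' p) :
  pairing b (tmap (koszul_incl k sub) P j z) t = pairing b z (freemap _ pr t).
Proof.
rewrite /pairing; under eq_bigr do rewrite chain_coef_incl mulr_suml.
rewrite exchange_big; apply: eq_bigr => J _ /=.
have JP : (val J \in faces Delta') && (#|val J|%:Z == j).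
  by have /andP [JD ->] := valP J; rewrite (subsetP sub).
rewrite (bigD1 (exist _ (val J) JP : face Delta' j)) //= eqxx mul1r big1 ?addr0.
  congr (_ * _); rewrite /dual_coef /=; congr (_ * _); apply: eq_bigr => L _.
  by rewrite ffunE sr_coef_proj ?face_in.
move=> J' ne; case: eqP => [eJ|_]; last by rewrite !mul0r.
by case/eqP: ne; apply/val_inj.
Qed.

Lemma tmap_freemap (C D : freeComplex k n) (h : chainMap C D) j u :
  tmap h A j (freemap (bdeg C j) pr u) = freemap (bdeg D j) pr (tmap h A' j u).
Proof.
apply/ffunP=> c; rewrite !ffunE raddf_sum; apply: eq_bigr => a _ /=.
by rewrite ffunE linearZ.
Qed.

Lemma tor_dual_natural (w : component (koszulModule k Delta i) b)
    (t : component (Tor F q A') b) :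
  tor_dual (component_map (koszulModule_map k sub i) w) t =
  tor_dual w (component_map (Tor_map F q pr) t).
Proof.
have hw : homologous (tdiff (koszulComplex k Delta') P (erefl (i + 1)))
    (wrep (component_map (koszulModule_map k sub i) w))
    (tmap (koszul_incl k sub) P i (wrep w)) by exact: hrep_map.
have ht : homologous (tdiff F A (erefl (q + 1)))
    (trep (component_map (Tor_map F q pr) t)) (freemap (bdeg F q) pr (trep t)).
  exact: hrep_map.
apply: etrans (pairing_tor_l (tmap_cycle f (trep_cycle t)) hw) _.
apply: etrans (esym (pairing_tor_r (wrep_cycle w) ht)).
by rewrite pairing_natural tmap_freemap.
Qed.

End Natural.
End Duality.

Theorem theorem1p1 (k : fieldType) (char0 : [pchar k] =i pred0) (n : nat)
    (F : freeResolution (residueField k n))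
    (i : nat) (i_ge1 : (1 <= i)%N)
    (b : 'X_{1..n}) (b_sqfree : forall l : 'I_n, (b l <= 1)%N) :
  exists phi : forall Delta : simplicialComplex n,
      {linear component (koszulModule k Delta i%:Z) b ->
        dual (component (Tor F ((mdeg b)%:Z - i%:Z) (stanleyReisner k Delta)) b)},
    (forall Delta, bijective (phi Delta)) /\
    (forall (Delta Delta' : simplicialComplex n)
        (sub : faces Delta \subset faces Delta')
        (w : component (koszulModule k Delta i%:Z) b)
        (t : component (Tor F ((mdeg b)%:Z - i%:Z) (stanleyReisner k Delta')) b),
      phi Delta' (component_map (koszulModule_map k sub i%:Z) w) t =
      phi Delta w
        (component_map (Tor_map F ((mdeg b)%:Z - i%:Z) (SR_proj k sub)) t)).
Proof.
have [f [g fgK]] := comparison F (koszulResolution k n).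
have hq : i%:Z + ((mdeg b)%:Z - i%:Z) = (mdeg b)%:Z by rewrite addrC subrK.
exists (fun Delta => tor_dual f b_sqfree hq (Delta := Delta)); split.
  by move=> Delta; apply: tor_dual_bij.
move=> Delta Delta' sub w t; exact: tor_dual_natural.
Qed.
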